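(* Let $w:I\to(0,\infty)$ be a decreasing weight on $I=(0,a)$, $0<a\le\infty$, with $W(t)=\int_0^t w\,dm<\infty$ for all $t\in I$. Let $b=\int_I w\,dm\in(0,\infty]$, $J=(0,b)$, and let $E$ be a fully symmetric Banach function space on $J$ with support $J$. Then $(\Lambda_{E,w})'=Q_{E',w}$ with equal norms.
   Context: $m$ is Lebesgue measure; functions are identified when equal a.e.; ''decreasing'' means non-increasing. $L^0(I)$ is the space of real Lebesgue measurable functions on $I$. For a measure $\mu$ and a $\mu$-measurable $f$ on $\Omega$, $d_f^\mu(s)=\mu\{|f|>s\}$ and $f^{*,\mu}(t)=\inf\{s>0:d_f^\mu(s)\le t\}$ for $0\le t<\mu(\Omega)$; $f^*$ is the rearrangement for $\mu=m$, and $f^{*,w}$ the rearrangement with respect to the measure $w\,dm$ on $I$, a function on $J$. For functions on the same interval ($I$ or $J$), $f\prec g$ means $\int_0^x f^*\,dm\le\int_0^x g^*\,dm$ for all $x$ in the interval. A Banach function space on an interval is a solid linear subspace $E$ of $L^0$ with full support, complete under a monotone norm ($|f|\le|g|$ a.e. implies $\|f\|_E\le\|g\|_E$). It is fully symmetric if equimeasurable functions have equal norms and $f\prec g$, $f\in L^0$, $g\in E$ imply $f\in E$ and $\|f\|_E\le\|g\|_E$. ''Support $J$'' means $\chi_A\in E$ whenever $m(A)<\infty$. The Köthe dual $F'$ of a Banach function space $F$ (on $J$ or $I$, Lebesgue measure) is the set of measurable $f$ with $\|f\|_{F'}=\sup\{\int|fg|\,dm:\|g\|_F\le1\}<\infty$.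 For a fully symmetric space $F$ on $J$: $F_w=\{f\in L^0(I):f^{*,w}\in F\}$, $\|f\|_{F_w}=\|f^{*,w}\|_F$; $\Lambda_{F,w}=\{f\in L^0(I):f^*\in F_w\}$, $\|f\|_{\Lambda_{F,w}}=\|f^*\|_{F_w}$; $M_{F,w}=\{f\in L^0(I): f^*/w\in F_w\}$ with gauge $\|f\|_{M_{F,w}}=\|f^*/w\|_{F_w}$. $Q_{F,w}$ is the set of $f\in L^0(I)$ such that $f\prec g$ for some $g\in M_{F,w}$, with norm $\|f\|_{Q_{F,w}}=\inf\{\|g\|_{M_{F,w}}: f\prec g\}$. *)

(* Defs.v *)
From mathcomp Require Import all_boot all_order all_algebra.
From mathcomp Require Import all_classical all_reals all_analysis.

Set Implicit Arguments.
Unset Strict Implicit.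
Unset Printing Implicit Defensive.
Import Order.TTheory GRing.Theory Num.Theory.
Import numFieldNormedType.Exports.

Local Open Scope classical_set_scope.
Local Open Scope ring_scope.

(* The real line with the sigma-algebra of all Lebesgue measurable sets (the
   Caratheodory sets of the outer Lebesgue measure), not only the Borel ones. *)
Notation lebesgueType R :=
  (caratheodory_type ((wlength (idfun : R -> R))^*)%mu).

Notation leb := (@completed_lebesgue_measure _).

Definition itv0 (R : realType) (a : \bar R) : set R :=
  [set x | 0 < x /\ (x%:E < a)%E].

Definition L0 (R : realType) (D : set R) : set (R -> R) :=
  [set f | measurable_fun (D : set (lebesgueType R)) f].

(* A property holding at almost every point of D. Functions on D are
   represented by functions R -> R whose values outside D play no role, and
   the identification of functions equal a.e. on D is left implicit. *)
Definition ae_on (R : realType) (D : set R) (P : R -> Prop) : Prop :=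
  {ae (leb : set (lebesgueType R) -> \bar R), forall x, D x -> P x}.

Definition wmeas (R : realType) (w : R -> R) (A : set R) : \bar R :=
  (\int[leb]_(x in (A : set (lebesgueType R))) (w x)%:E)%E.

Section rearrangement.
Variable R : realType.
Implicit Types (mu : set R -> \bar R) (D : set R) (f g : R -> R).

Definition distr mu D f (s : R) : \bar R := mu (D `&` [set x | s < `|f x|]).

(* Extended-valued: the infimum of the empty set is +oo. *)
Definition rearr mu D f (t : R) : \bar R :=
  ereal_inf (EFin @` [set s : R | 0 < s /\ (distr mu D f s <= t%:E)%E]).

Definition equimeasurable D f g : Prop :=
  forall s : R, 0 < s -> distr leb D f s = distr leb D g s.

(* The relation f \prec g on D = (0, a). *)
Definition submajorized D f g : Prop :=
  forall x : R, D x ->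
    (\int[leb]_(t in (itv0 x%:E : set (lebesgueType R))) rearr leb D f t
     <= \int[leb]_(t in (itv0 x%:E : set (lebesgueType R))) rearr leb D g t)%E.

End rearrangement.

(* A set of functions with a gauge; the values of the gauge outside the set
   are irrelevant. *)
Record funSpace (R : realType) := FunSpace {
  fcarrier :> (R -> R) -> Prop ;
  fnorm : (R -> R) -> R }.

Record is_banach_function_space (R : realType) (D : set R) (E : funSpace R)
    : Prop := IsBanachFunctionSpace {
  bfs_sub : forall f, E f -> L0 D f ;
  bfs_zero : E (fun=> 0) ;
  bfs_add : forall f g, E f -> E g -> E (f \+ g) ;
  bfs_scale : forall (c : R) f, E f -> E (fun x => c * f x) ;
  bfs_solid : forall f g, L0 D f -> E g ->
    ae_on D (fun x => `|f x| <= `|g x|) -> E f ;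
  bfs_full_support : forall A : set (lebesgueType R),
    measurable A -> A `<=` D -> (0 < leb A)%E ->
    exists2 f, E f & ~ ae_on A (fun x => f x = 0) ;
  bfs_norm_ge0 : forall f, E f -> 0 <= fnorm E f ;
  bfs_norm_eq0 : forall f, E f -> fnorm E f = 0 -> ae_on D (fun x => f x = 0) ;
  bfs_normZ : forall (c : R) f, E f ->
    fnorm E (fun x => c * f x) = `|c| * fnorm E f ;
  bfs_normD : forall f g, E f -> E g ->
    fnorm E (f \+ g) <= fnorm E f + fnorm E g ;
  bfs_norm_mono : forall f g, E f -> E g ->
    ae_on D (fun x => `|f x| <= `|g x|) -> fnorm E f <= fnorm E g ;
  bfs_complete : forall u : nat -> R -> R,
    (forall n, E (u n)) ->
    (forall e : R, 0 < e -> exists N : nat, forall m n : nat,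
      (N <= m)%N -> (N <= n)%N -> fnorm E (u m \- u n) < e) ->
    exists2 f, E f & (fun n => fnorm E (u n \- f)) @ \oo --> (0 : R) }.

Record is_fully_symmetric (R : realType) (D : set R) (E : funSpace R)
    : Prop := IsFullySymmetric {
  fs_equi : forall f g, E f -> E g -> equimeasurable D f g ->
    fnorm E f = fnorm E g ;
  fs_sub : forall f g, L0 D f -> E g -> submajorized D f g ->
    E f /\ fnorm E f <= fnorm E g }.

Definition has_support (R : realType) (D : set R) (E : funSpace R) : Prop :=
  forall A : set (lebesgueType R),
    measurable A -> A `<=` D -> (leb A < +oo)%E -> E (\1_A).

Section spaces.
Variable R : realType.
Implicit Types (D I J : set R) (F : funSpace R) (w f g : R -> R).

(* Membership in F, and gauge, of an extended-valued function h on D: a member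
   of F is a real function, so h has to be finite a.e. on D. *)
Definition emem D F (h : R -> \bar R) : Prop :=
  ae_on D (fun t => h t \is a fin_num) /\ F (fine \o h).

Definition enorm F (h : R -> \bar R) : R := fnorm F (fine \o h).

Definition kothe_gauge D F f : \bar R :=
  ereal_sup [set (\int[leb]_(x in (D : set (lebesgueType R)))
                    `|f x * g x|%:E)%E | g in [set g | F g /\ fnorm F g <= 1]].

Definition kothe_dual D F : funSpace R :=
  FunSpace [set f | L0 D f /\ (kothe_gauge D F f < +oo)%E]
           (fun f => fine (kothe_gauge D F f)).

(* In the following definitions F is a space on J and the result a space
   on I, where J = (0, b) and b = wmeas w I. *)

Definition weighted_space I J w F : funSpace R :=
  FunSpace [set f | L0 I f /\ emem J F (rearr (wmeas w) I f)]
           (fun f => enorm F (rearr (wmeas w) I f)).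

Definition Lambda_space I J w F : funSpace R :=
  FunSpace [set f | L0 I f /\ emem I (weighted_space I J w F) (rearr leb I f)]
           (fun f => enorm (weighted_space I J w F) (rearr leb I f)).

Definition rearr_div I w f (t : R) : \bar R :=
  (rearr leb I f t * ((w t)^-1)%:E)%E.

Definition M_space I J w F : funSpace R :=
  FunSpace [set f | L0 I f /\ emem I (weighted_space I J w F) (rearr_div I w f)]
           (fun f => enorm (weighted_space I J w F) (rearr_div I w f)).

Definition Q_space I J w F : funSpace R :=
  FunSpace [set f | L0 I f /\ exists2 g, M_space I J w F g & submajorized I f g]
           (fun f => inf [set fnorm (M_space I J w F) g |
                          g in [set g | M_space I J w F g /\
                                        submajorized I f g]]).

End spaces.

(* Main.v *)
Require Import Defs.
From mathcomp Require Import all_boot all_order all_algebra.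
From mathcomp Require Import all_classical all_reals all_analysis measurable_realfun.
From mathcomp Require Import ring lra.

(* Write F(x) for the integral of the rearrangement of f over (0, x), W for the
   primitive of w. Let L be the slope of the least majorant of F which is concave
   as a function of W (Halperin's level function), so that f \prec L w and L w
   is nonincreasing. For every g in M with f \prec g, the pairing of f with u is
   at most the M-gauge of g times the Lambda-norm of u, by three applications of
   the Hardy-Littlewood inequality. Conversely L w has M-gauge at most
   the norm of f in the dual of Lambda: replacing a decreasing u on J by its
   averages over the intervals where F lies below its majorant produces a
   function submajorized by u, and the pairing of L with u becomes the pairing
   of f with a step function, which is attained on sets of the given measures
   because (0, a) has no atoms.

   Integrals of products are compared through finite layer sums
   sum_k e * 1_{phi > (k+1) e}; this avoids both Fubini's theorem on the
   completed measure and the change of variables by the inverse of W. *)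

Set Implicit Arguments.
Unset Strict Implicit.
Unset Printing Implicit Defensive.
Import Order.TTheory GRing.Theory Num.Theory.
Import numFieldNormedType.Exports.
Local Open Scope classical_set_scope.
Local Open Scope ring_scope.

(** The converse has to work although the norm of [E] may be neither order continuous nor Fatou, so
    monotone limits cannot be taken inside it. Every test function is therefore a finite step
    function built for finitely many levels of [L]; finer layers, exhaustion of level sets and
    removal of truncations only concern integrals against one fixed [u], all bounded by the same
    constant. Averaging does not lose any of the pairing because the endpoints of the averaging
    intervals maximize [F - s W], among finitely many candidates, for the successive levels [s]:
    between two endpoints the chord of [F] over [W] has slope at least the level, and summation by
    parts turns this into the required inequality. That [F] is finite and that the slopes defining
    [L] are bounded is not given; both follow by testing the dual norm on indicators of initial
    intervals. Since [L w] has gauge at most the dual norm, the infimum in the norm of [Q] is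
    attained there. *)

(** * Intervals and downward closed subsets of the half-line *)

Section lebesgue_intervals.
Context {R : realType}.
Local Notation T := (lebesgueType R).
Implicit Types (A B D : set R) (c d : \bar R).

Lemma lebesgueT_measurable A :
  measurable (A : set (measurableTypeR R)) -> measurable (A : set T).
Proof. exact: sub_caratheodory. Qed.

Lemma measurable_itvT (i : interval R) : measurable ([set` i] : set T).
Proof. by apply: lebesgueT_measurable; exact: measurable_itv. Qed.

Lemma itv0_fin (r : R) : itv0 r%:E = `]0, r[%classic.
Proof.
by apply/funext => x; rewrite /itv0 /= in_itv /= lte_fin; apply/propext; split=> /andP.
Qed.

Lemma itv0_pinfty : itv0 +oo%E = `]0, +oo[%classic :> set R.
Proof.
apply/funext => x; rewrite /itv0 /= in_itv /= andbT ltry.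
by apply/propext; split=> [[]|].
Qed.

Lemma itv0_ninfty : itv0 -oo%E = set0 :> set R.
Proof. by apply/seteqP; split=> x; rewrite /itv0 /= => -[]. Qed.

Lemma measurable_itv0 c : measurable (itv0 c : set T).
Proof.
case: c => [r| |]; rewrite ?itv0_fin ?itv0_pinfty ?itv0_ninfty //;
  exact: measurable_itvT.
Qed.

Lemma leb_itv0 c : (0 <= c)%E -> leb (itv0 c : set T) = c.
Proof.
case: c => [r| |] //.
- rewrite lee_fin itv0_fin => r0.
  rewrite [LHS](_ : _ = lebesgue_measure (`]0, r[%classic : set R)) //.
  rewrite lebesgue_measure_itv /= lte_fin; case: ltP => [_|r0'].
    by rewrite oppr0 adde0.
  by rewrite (@le_anti _ _ r 0) // r0 r0'.
- rewrite itv0_pinfty.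
  rewrite [LHS](_ : _ = lebesgue_measure (`]0, +oo[%classic : set R)) //.
  by rewrite lebesgue_measure_itv /= ltry.
Qed.

Lemma subset_itv0 c d : (c <= d)%E -> itv0 c `<=` itv0 d.
Proof. by move=> cd x [x0 xc]; split=> //; exact: lt_le_trans cd. Qed.

Lemma itv0I c d : itv0 c `&` itv0 d = itv0 (Order.min c d).
Proof.
apply/seteqP; split=> x; first by move=> [[x0 xc] [_ xd]]; split => //; rewrite lt_min xc.
by move=> [x0]; rewrite lt_min => /andP[xc xd].
Qed.

Definition downset D A := forall x y, A y -> D x -> x <= y -> A x.

Lemma downset_measurable c A : A `<=` itv0 c -> downset (itv0 c) A ->
  measurable (A : set T).
Proof.
move=> Ac Ad; apply: lebesgueT_measurable.
suff : is_interval A by move/is_intervalP => ->; exact: measurable_itv.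
move=> x y Ax Ay z /andP[xz zy]; apply: (Ad _ y) => //.
have [x0 _] := Ac _ Ax; have [_ yc] := Ac _ Ay.
split; first exact: lt_le_trans xz.
by apply: le_lt_trans yc; rewrite lee_fin.
Qed.

(** Such a set is an interval starting at 0 whose right endpoint may or may not belong to it.
    Half-open pieces ending at points of [A] treat both cases at once; for superlevel sets of [L]
    they supply points at which [L] really exceeds the level. *)
Lemma downset_exhaust c A : A `<=` itv0 c -> downset (itv0 c) A -> A !=set0 ->
  exists2 p : nat -> R, {homo p : m n / (m <= n)%N >-> m <= n} &
    (forall n, A (p n)) /\ A = \bigcup_n `]0, p n]%classic.
Proof.
move=> Ac Ad [x0 Ax0].
suff [p pmon [pA pcof]] : exists2 p : nat -> R,
    {homo p : m n / (m <= n)%N >-> m <= n} &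
    (forall n, A (p n)) /\ forall x, A x -> exists n, x <= p n.
  exists p => //; split=> //; apply/seteqP; split=> x.
    move=> Ax; have [n xn] := pcof _ Ax; exists n => //=.
    by rewrite in_itv /= xn andbT; case: (Ac _ Ax).
  move=> [n _] /=; rewrite in_itv /= => /andP[x_gt0 xn].
  apply: (Ad _ (p n)) => //; split=> //.
  by have [_] := Ac _ (pA n); apply: le_lt_trans; rewrite lee_fin.
suff [q qA qcof] : exists2 q : nat -> R, (forall n, A (q n)) &
    forall x, A x -> exists n, x <= q n.
  (* Running maxima make a merely cofinal sequence monotone and stay in [A]. *)
  pose p := fix p n := if n is m.+1 then Order.max (p m) (q n) else q 0%N.
  have qp n : q n <= p n by case: n => //= n; rewrite le_max lexx orbT.
  exists p.
    by apply/nondecreasing_seqP => n /=; rewrite le_max lexx.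
  split=> [|x /qcof[n xn]]; last by exists n; exact: le_trans (qp n).
  by elim=> [|n ih] //=; rewrite /Order.max; case: ifP.
have [ubA|nubA] := pselect (has_ubound A); last first.
  have nub n : exists x, A x /\ n%:R <= x.
    apply: contrapT => nx; apply: nubA; exists n%:R => x Ax.
    by rewrite leNgt; apply/negP => /ltW nx'; apply: nx; exists x.
  exists (fun n => projT1 (cid (nub n))).
    by move=> n; case: cid => ? [].
  move=> x Ax; exists (Num.bound x); case: cid => y [yA yn] /=.
  apply: le_trans yn.
  by apply/ltW/archi_boundP; case: (Ac _ Ax) => /ltW.
have hsA : has_sup A by split=> //; exists x0.
have [As|nAs] := pselect (A (sup A)).
  by exists (fun=> sup A) => // x Ax; exists 0%N; exact: ub_le_sup.
have adh n : exists2 x, A x & sup A - n.+1%:R^-1 < x.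
  by apply: sup_adherent.
exists (fun n => projT1 (cid2 (adh n))) => [n|x Ax]; first by case: cid2.
have xs : 0 < sup A - x.
  rewrite subr_gt0 lt_neqAle ub_le_sup // andbT.
  by apply/eqP => xs; apply: nAs; rewrite -xs.
exists (Num.bound (sup A - x)^-1); case: cid2 => y yA /= /ltW yn.
apply: le_trans yn; rewrite lerBrDl -lerBrDr.
rewrite invf_ple ?posrE // ?ltr0n //; apply/ltW.
apply: lt_le_trans (archi_boundP _) _; first by rewrite invr_ge0 ltW.
by rewrite ler_nat.
Qed.

End lebesgue_intervals.

(** * Layer sums for integrals of products *)

Section layers.
Local Open Scope ereal_scope.
Context d (T : measurableType d) (R : realType).
Variables (mu : {measure set T -> \bar R}) (D : set T) (mD : measurable D).
Variables phi psi : T -> \bar R.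
Hypotheses (mphi : measurable_fun D phi) (mpsi : measurable_fun D psi).
Hypotheses (phi0 : forall x, D x -> 0 <= phi x)
           (psi0 : forall x, D x -> 0 <= psi x).

(** For positive [e] and [y], the largest multiple of [e] strictly below [y] among those up to
    [K * e]. The strict inequality matches the open superlevel sets in [distr]. *)
Let height (e : R) K (y : \bar R) : R :=
  (\sum_(k < K) if ((k.+1%:R * e)%:E < y)%E then e else 0)%R.

Let height_full e K (y : \bar R) : (0 <= e)%R ->
  (K%:R * e)%:E < y -> height e K y = (K%:R * e)%R.
Proof.
move=> e0 Ky; rewrite /height (eq_bigr (fun=> e)) => [|k _].
  by rewrite sumr_const card_ord mulr_natl.
rewrite ifT // (le_lt_trans _ Ky) // lee_fin ler_wpM2r // ler_nat.
exact: ltn_ord.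
Qed.

Let height_le e K (y : \bar R) : (0 <= e)%R -> 0 <= y -> (height e K y)%:E <= y.
Proof.
move=> e0 y0; elim: K => [|K ih]; first by rewrite /height big_ord0.
case: (ltP (K.+1%:R * e)%:E y) => Ky; first by rewrite height_full // ltW.
by rewrite /height big_ord_recr /= ltNge Ky /= addr0.
Qed.

Let height_ge e K (y : \bar R) : (0 <= e)%R -> 0 <= y ->
  y <= (height e K y + e)%:E \/ (K%:R * e <= height e K y)%R.
Proof.
move=> e0 y0; elim: K => [|K ih].
  by right; rewrite mul0r /height big_ord0.
case: (ltP (K.+1%:R * e)%:E y) => Ky; first by right; rewrite height_full.
have -> : height e K.+1 y = height e K y.
  by rewrite /height big_ord_recr /= ltNge Ky /= addr0.
case: ih => [|ih]; first by left.
left; apply: le_trans Ky _; rewrite lee_fin.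
by rewrite -natr1 mulrDl mul1r lerD2r.
Qed.

Let e_ (n : nat) : R := (n.+1%:R^-1)%R.

Let e_gt0 n : (0 < e_ n)%R. Proof. by rewrite invr_gt0 ltr0n. Qed.

(** With mesh [1/(n+1)] and [(n+1)^2] layers the cap is [n+1]: the mesh tends to 0 while the cap
    tends to infinity, which also covers [y = +oo]. *)
Let height_cvg (y : \bar R) : 0 <= y ->
  (height (e_ n) (n.+1 * n.+1)%N y)%:E @[n --> \oo] --> y.
Proof.
have Ke n : ((n.+1 * n.+1)%:R * e_ n = n.+1%:R :> R)%R.
  by rewrite natrM mulfK // pnatr_eq0.
case: y => [y| |] // y0.
- apply: cvg_EFin; first exact: nearW.
  apply: (@squeeze_cvgr _ _ _ _ (fun n => y - e_ n)%R (fun=> y)); last 2 first.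
  + rewrite -[X in _ --> X]subr0; apply: cvgB; first exact: cvg_cst.
    exact: cvg_harmonic.
  + exact: cvg_cst.
  near=> n; apply/andP; split; last by rewrite -lee_fin height_le // ltW.
  have [|] := @height_ge (e_ n) (n.+1 * n.+1)%N y%:E (ltW (e_gt0 n)) y0.
    by rewrite lee_fin lerBlDr.
  rewrite Ke; apply: le_trans; rewrite lerBlDr.
  apply: (@le_trans _ _ n.+1%:R%R); last by rewrite lerDl ltW.
  apply: (@le_trans _ _ n%:R%R); last by rewrite ler_nat.
  by near: n; exact: nbhs_infty_ger.
- apply/cvgeyPge => A; near=> n; rewrite lee_fin.
  have [//|] := @height_ge (e_ n) (n.+1 * n.+1)%N +oo (ltW (e_gt0 n)) y0.
  rewrite Ke; apply: le_trans.
  apply: (@le_trans _ _ n%:R%R); last by rewrite ler_nat.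
  by near: n; exact: nbhs_infty_ger.
Unshelve. all: by end_near. Qed.

Let level (r : R) : set T := D `&` [set x | r%:E < phi x].

Let mlevel (r : R) : measurable (level r).
Proof. exact: emeasurable_fun_o_infty. Qed.

Let lay (e : R) K (x : T) : \bar R :=
  \sum_(k < K) e%:E * (psi \_ (level (k.+1%:R * e))) x.

Let layE e K x : (0 <= e)%R -> D x -> lay e K x = (height e K (phi x))%:E * psi x.
Proof.
move=> e0 Dx; rewrite /lay /height -sumEFin ge0_sume_distrl => [|k _]; last first.
  by case: ifP.
apply: eq_bigr => k _; rewrite patchE; case: ifPn => kx.
  by move: kx; rewrite inE => -[_ /= ->].
rewrite ifF ?mul0e ?mule0 //; apply/negbTE; apply: contra kx => kx.
by rewrite inE; split.
Qed.

Let mpatch r : measurable_fun D (psi \_ (level r)).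
Proof.
apply/measurable_restrict => //.
by apply: measurable_funS mpsi => //; exact: subIsetl.
Qed.

Let mlay e K : measurable_fun D (lay e K).
Proof. by apply: emeasurable_sum => k; exact: measurable_funeM. Qed.

Let lay_ge0 e K x : (0 <= e)%R -> D x -> 0 <= lay e K x.
Proof.
move=> e0 Dx; rewrite layE // mule_ge0 ?psi0 // lee_fin.
by apply: sumr_ge0 => k _; case: ifP.
Qed.

Let int_lay e K : (0 <= e)%R ->
  \int[mu]_(x in D) lay e K x =
  \sum_(k < K) e%:E *
    \int[mu]_(x in D `&` [set x | (k.+1%:R * e)%:E < phi x]) psi x.
Proof.
move=> e0; have p0 r x : D x -> 0 <= (psi \_ (level r)) x.
  by move=> Dx; rewrite patchE; case: ifP => // _; exact: psi0.
rewrite /lay (@ge0_integral_sum _ _ _ mu D mD 'I_K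
  (fun k x => e%:E * (psi \_ (level (k.+1%:R * e))) x)) //.
- apply: eq_bigr => k _; rewrite ge0_integralZl_EFin //.
    congr (_ * _); rewrite -integral_mkcondr /level setIA setIid //.
  by move=> x; exact: p0.
- by move=> k; exact: measurable_funeM.
- by move=> k x Dx; rewrite mule_ge0 ?lee_fin ?p0.
Qed.

Lemma layer_le (e : R) K : (0 <= e)%R ->
  \sum_(k < K) e%:E *
    \int[mu]_(x in D `&` [set x | (k.+1%:R * e)%:E < phi x]) psi x
  <= \int[mu]_(x in D) (phi x * psi x).
Proof.
move=> e0; rewrite -int_lay //; apply: ge0_le_integral => //.
- by move=> x Dx; exact: lay_ge0.
- exact: emeasurable_funM.
- move=> x Dx; rewrite layE // lee_wpmul2r ?psi0 //.
  by apply: height_le => //; exact: phi0.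
Qed.

(** Fatou's lemma is used instead of monotone convergence, since the grids of mesh [1/(n+1)] are not
    nested and the layer sums need not increase with [n]. *)
Lemma le_layer (C : \bar R) :
  (forall (e : R) K, (0 < e)%R -> \sum_(k < K) e%:E *
    \int[mu]_(x in D `&` [set x | (k.+1%:R * e)%:E < phi x]) psi x <= C) ->
  \int[mu]_(x in D) (phi x * psi x) <= C.
Proof.
move=> leC; pose f n := lay (e_ n) (n.+1 * n.+1)%N.
have -> : \int[mu]_(x in D) (phi x * psi x) =
          \int[mu]_(x in D) limn_einf (f^~ x).
  apply: eq_integral => x; rewrite inE => Dx.
  have fcvg : (f^~ x) @ \oo --> phi x * psi x.
    rewrite (_ : f^~ x =
      fun n => (height (e_ n) (n.+1 * n.+1) (phi x))%:E * psi x); last first.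
      by apply/funext => n; rewrite /f layE // ltW.
    have [->|phin0] := eqVneq (phi x) 0.
      rewrite mul0e; apply: cvg_near_cst; apply: nearW => n.
      rewrite /height big1 ?mul0e // => k _.
      by rewrite ltNge lee_fin mulr_ge0 // ltW.
    have [->|psin0] := eqVneq (psi x) 0.
      by rewrite mule0; apply: cvg_near_cst; apply: nearW => n; rewrite mule0.
    apply: cvgeM.
    - by apply: neq0_mule_def; rewrite mule_eq0 negb_or phin0.
    - by apply: height_cvg; exact: phi0.
    - exact: cvg_cst.
  rewrite is_cvg_limn_einfE; first by apply/esym/cvg_lim.
  by apply/cvg_ex; eexists; exact: fcvg.
apply: le_trans (fatou mu mD _ _) _.
- by move=> n; exact: mlay.
- by move=> n x Dx; apply: lay_ge0 => //; rewrite ltW.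
rewrite limn_einf_lim; apply: lime_le.
  exact: is_cvg_einfs.
apply: nearW => n; apply: ge_ereal_inf.
exists (\int[mu]_(x in D) f n x); first by exists n => //=.
by rewrite int_lay ?leC // ltW.
Qed.

End layers.

(** * Measurability, distribution functions and rearrangements for [w dm] *)

Section measurable_functions.
Context {R : realType}.
Local Notation T := (lebesgueType R).
Implicit Types (D : set T) (f g : R -> R).

Lemma L0M D f g : L0 D f -> L0 D g -> L0 D (fun x => f x * g x).
Proof. exact: (@measurable_funM _ T R D f g). Qed.

Lemma L0_norm D f : L0 D f -> L0 D (fun x => `|f x|).
Proof. by move=> mf; apply: measurableT_comp. Qed.

Lemma L0_EFin D f : L0 D f -> measurable_fun D (fun x => (f x)%:E).
Proof. by move=> mf; apply/measurable_EFinP. Qed.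

Lemma L0S D D' f : measurable D -> D' `<=` D -> L0 D f -> L0 D' f.
Proof. by move=> mD DD' mf; exact: measurable_funS mf. Qed.

End measurable_functions.

Section weighted_measure.
Local Open Scope ereal_scope.
Context {R : realType}.
Local Notation T := (lebesgueType R).
Variables (D : set R) (w : R -> R).
Hypotheses (mD : measurable (D : set T)) (w0 : forall x, D x -> (0 <= w x)%R)
  (mw : L0 D w).

Lemma wmeas_ge0 (A : set R) : A `<=` D -> 0 <= wmeas w A.
Proof. by move=> AD; apply: integral_ge0 => x /AD /w0; rewrite lee_fin. Qed.

Let mEw (A : set T) : measurable A -> A `<=` D -> measurable_fun A (EFin \o w).
Proof.
by move=> mA AD; apply/measurable_EFinP; apply: measurable_funS mw.
Qed.

Lemma wmeas_le (A B : set T) : measurable A -> measurable B -> A `<=` B ->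
  B `<=` D -> wmeas w A <= wmeas w B.
Proof.
move=> mA mB AB BD.
apply: (@ge0_subset_integral _ T R leb A B mA mB (EFin \o w)) => //.
  exact: mEw.
by move=> x /BD /w0; rewrite lee_fin.
Qed.

Lemma wmeas_bigcup_le (F : nat -> set T) c : (forall n, measurable (F n)) ->
  {homo F : m n / (m <= n)%N >-> m `<=` n} -> (forall n, F n `<=` D) ->
  (forall n, wmeas w (F n) <= c) -> wmeas w (\bigcup_n F n) <= c.
Proof.
move=> mF homoF FD Fc.
have ndF : nondecreasing_seq F by move=> m n mn; rewrite subsetEset; exact: homoF.
have cvgF := @ge0_nondecreasing_set_cvg_integral _ _ _ F (EFin \o w) leb ndF mF
  (fun i => mEw (mF i) (FD i)) (fun i x Fx => w0 (FD i x Fx)).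
have -> : wmeas w (\bigcup_n F n) =
    limn (fun n => \int[leb]_(x in F n) (EFin \o w) x).
  by apply/esym; exact: cvg_lim cvgF.
apply: lime_le; first exact: (cvgP _ cvgF).
by apply: nearW => n; exact: Fc.
Qed.

Lemma measurable_distr_set (f : R -> R) (s : R) : L0 D f ->
  measurable (D `&` [set x | (s < `|f x|)%R] : set T).
Proof.
move=> mf; have mf' : measurable_fun (D : set T) (fun x => `|f x|%:E).
  by apply/measurable_EFinP; exact: measurableT_comp.
rewrite (_ : [set x | _] = [set x | s%:E < `|f x|%:E]); last first.
  by apply/funext => x /=; rewrite lte_fin.
exact: (@emeasurable_fun_o_infty _ T R D (fun x => `|f x|%:E) mD mf' s%:E).
Qed.

Lemma distr_le_wmeas (f : R -> R) (s : R) : L0 D f ->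
  distr (wmeas w) D f s <= wmeas w D.
Proof.
by move=> mf; apply: wmeas_le => //; exact: measurable_distr_set.
Qed.

Lemma distr_anti (f : R -> R) (s s' : R) : L0 D f -> (s <= s')%R ->
  distr (wmeas w) D f s' <= distr (wmeas w) D f s.
Proof.
move=> mf ss'; apply: wmeas_le => //; try exact: measurable_distr_set.
by move=> x [Dx] /=; split=> //; exact: le_lt_trans ss' _.
Qed.

(** The distribution function is right continuous: a superlevel set is the increasing union of those
    at heights [s + 1/(n+1)], and continuity from below requires no finite measure. This makes the
    two strict inequalities correspond exactly. *)
Lemma lt_rearr (f : R -> R) (t s : R) : L0 D f -> (0 <= s)%R ->
  (s%:E < rearr (wmeas w) D f t) = (t%:E < distr (wmeas w) D f s).
Proof.
move=> mf s0; apply/idP/idP; last first.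
  apply: contraTT; rewrite -!leNgt => rs; pose e n : R := (s + n.+1%:R^-1)%R.
  rewrite [leLHS](_ : _ = wmeas w (\bigcup_n (D `&` [set x | (e n < `|f x|)%R]))).
  apply: wmeas_bigcup_le => //.
  - by move=> n; exact: measurable_distr_set.
  - move=> m n mn x [Dx] /= mx; split=> //=; apply: le_lt_trans mx.
    by rewrite lerD2l lef_pV2 ?posrE ?ltr0n // ler_nat.
  - move=> n; rewrite leNgt; apply/negP => tn.
    move: rs; apply/negP; rewrite -ltNge.
    apply: (@lt_le_trans _ _ (e n)%:E).
      by rewrite lte_fin ltrDl invr_gt0 ltr0n.
    apply: le_ereal_inf_tmp => _ [r [r0 rt] <-]; rewrite lee_fin leNgt.
    apply/negP => re; move: tn; apply/negP; rewrite -leNgt.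
    by apply: le_trans rt; apply: distr_anti => //; exact: ltW.
  congr (wmeas w _); apply/seteqP; split=> x.
    move=> [Dx] /=; rewrite -subr_gt0 => sx.
    exists (Num.bound (`|f x| - s)^-1) => //; split=> //=; rewrite /e.
    rewrite -ltrBrDl invf_plt ?posrE ?ltr0n //.
    apply: (lt_le_trans (archi_boundP _)); first by rewrite invr_ge0 ltW.
    by rewrite ler_nat.
  move=> [n _] [Dx] /= h; split=> //=; apply: lt_trans h.
  by rewrite ltrDl invr_gt0 ltr0n.
apply: contraTT; rewrite -!leNgt => ds.
(* The infimum ranges over positive heights, so [s = 0] is only approached, through all small
   [e > 0]. *)
move: s0; rewrite le_eqVlt => /predU1P[s0|s0]; last first.
  by apply: ereal_inf_lbound; exists s.
apply/lee_addgt0Pr => e e0; rewrite -s0 add0e; apply: ereal_inf_lbound.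
exists e => //; split=> //; apply: le_trans ds; apply: distr_anti => //.
by rewrite -s0 ltW.
Qed.

Lemma rearr_ge0 mu (f : R -> R) t : 0 <= rearr mu D f t.
Proof. by apply: le_ereal_inf_tmp => _ [r [r0 rt] <-]; rewrite lee_fin ltW. Qed.

Lemma rearr_anti mu (f : R -> R) t t' : (t <= t')%R ->
  rearr mu D f t' <= rearr mu D f t.
Proof.
move=> tt'; apply: ereal_inf_le_tmp => _ [r [r0 rt] <-]; exists r => //.
by split=> //; apply: le_trans rt _; rewrite lee_fin.
Qed.

Lemma level_rearr (f : R -> R) (s : R) c : L0 D f -> (0 <= s)%R ->
  itv0 c `&` [set t | s%:E < rearr (wmeas w) D f t] =
  itv0 c `&` itv0 (distr (wmeas w) D f s).
Proof.
move=> mf s0; apply/seteqP; split=> t [[t0 tc] /=]; rewrite lt_rearr //.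
by move=> [_ td]; split.
Qed.

Lemma rearr_le (f : R -> R) (t s : R) : L0 D f -> (0 <= s)%R ->
  (rearr (wmeas w) D f t <= s%:E) = (distr (wmeas w) D f s <= t%:E).
Proof. by move=> mf s0; rewrite !leNgt lt_rearr. Qed.

Lemma rearr_mono (f g : R -> R) t : L0 D f -> L0 D g ->
  (forall x, D x -> (`|f x| <= `|g x|)%R) ->
  rearr (wmeas w) D f t <= rearr (wmeas w) D g t.
Proof.
move=> mf mg fg; apply: ereal_inf_le_tmp => _ [r [r0 rt] <-]; exists r => //.
split=> //; apply: le_trans rt; apply: wmeas_le => //; try exact: measurable_distr_set.
by move=> x [Dx] /= h; split=> //=; apply: lt_le_trans h _; exact: fg.
Qed.

End weighted_measure.

Section monotone_measurable.
Local Open Scope ereal_scope.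
Context {R : realType}.
Local Notation T := (lebesgueType R).

Lemma nonincreasing_emeasurable c (h : R -> \bar R) :
  {in itv0 c &, {homo h : x y / (x <= y)%R >-> y <= x}} ->
  measurable_fun (itv0 c : set T) h.
Proof.
move=> hd; apply: (measurability _ (ErealGenOInfty.measurableE R)).
move=> /= _ [_ [r ->]] <-; apply: (@downset_measurable _ c); first exact: subIsetl.
move=> x y [Dy hy] Dx xy; split=> //.
move: hy; rewrite preimage_itvoy /= => hy; apply: lt_le_trans hy _.
by apply: hd => //; rewrite inE.
Qed.

Lemma nonincreasing_L0 c (h : R -> R) :
  {in itv0 c &, {homo h : x y / (x <= y)%R >-> (y <= x)%R}} -> L0 (itv0 c) h.
Proof.
move=> hd; apply/measurable_EFinP; apply: nonincreasing_emeasurable.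
by move=> x y Dx Dy xy; rewrite lee_fin; exact: hd.
Qed.

Lemma measurable_rearr mu D (f : R -> R) c :
  measurable_fun (itv0 c : set T) (rearr mu D f).
Proof. by apply: nonincreasing_emeasurable => x y _ _; exact: rearr_anti. Qed.

(** Lebesgue measure is treated as the weight 1, so that the lemmas on [wmeas] serve for [leb] as
    well. *)
Lemma wmeas1 (A : set T) : measurable A -> wmeas (fun=> 1%R) A = leb A.
Proof. by move=> mA; rewrite /wmeas integral_cst // mul1e. Qed.

Lemma distr_leb (D : set T) f : measurable D -> L0 D f ->
  distr leb D f = distr (wmeas (fun=> 1%R)) D f.
Proof.
move=> mD mf; apply/funext => s; rewrite /distr wmeas1 //.
exact: measurable_distr_set.
Qed.

Lemma rearr_leb (D : set T) f : measurable D -> L0 D f ->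
  rearr leb D f = rearr (wmeas (fun=> 1%R)) D f.
Proof. by move=> mD mf; apply/funext => t; rewrite /rearr distr_leb. Qed.

End monotone_measurable.

Lemma integral_itv0_cst {R : realType} (r : R) (c : \bar R) : (0 <= c)%E ->
  (\int[leb]_(x in (itv0 c : set (lebesgueType R))) r%:E = r%:E * c)%E.
Proof.
move=> c0; rewrite integral_cst; last exact: measurable_itv0.
by congr (_ * _)%E; exact: leb_itv0.
Qed.

(** * The Hardy-Littlewood inequality for [w dm] *)

Section hardy_littlewood.
Local Open Scope ereal_scope.
Context {R : realType}.
Local Notation T := (lebesgueType R).
Variables (D : set R) (w : R -> R).
Hypotheses (mD : measurable (D : set T)) (w0 : forall x, D x -> (0 <= w x)%R)
  (mw : L0 D w).

(** A layer on the left is the [w]-measure of [A] cut by a superlevel set, hence at most the smaller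
    of two measures; on the right the same layer is the length of the intersection of two intervals
    starting at 0, which is exactly that minimum. *)
Lemma hardy_littlewood_set (A : set T) (f : R -> R) :
  measurable A -> A `<=` D -> L0 D f ->
  \int[leb]_(x in A) (`|f x| * w x)%:E <=
  \int[leb]_(t in (itv0 (wmeas w A) : set T)) rearr (wmeas w) D f t.
Proof.
move=> mA AD mf.
have mfA : measurable_fun A (fun x => `|f x|%:E).
  by apply/measurable_EFinP; apply: measurableT_comp => //; exact: measurable_funS mf.
have mwA : measurable_fun A (EFin \o w).
  by apply/measurable_EFinP; exact: measurable_funS mw.
under eq_integral do rewrite EFinM.
apply: (@le_layer _ _ _ _ A mA (fun x => `|f x|%:E) (EFin \o w)) => //.
  by move=> x Ax; rewrite lee_fin w0 //; exact: AD.
move=> e K e0.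
have := @layer_le _ T R leb _ (measurable_itv0 (wmeas w A)) (rearr (wmeas w) D f)
  (cst 1) (@measurable_rearr _ _ _ _ _) (@measurable_cst _ _ _ _ _ _)
  (fun _ _ => rearr_ge0 _ _ _ _) (fun _ _ => lee01) e K (ltW e0).
under eq_integral do rewrite mule1; apply: le_trans.
apply: lee_sum => k _; apply: lee_wpmul2l; first by rewrite lee_fin ltW.
have s0 : (0 <= k.+1%:R * e)%R by rewrite mulr_ge0 // ltW.
rewrite level_rearr //.
have d0 : 0 <= distr (wmeas w) D f (k.+1%:R * e).
  by apply: (wmeas_ge0 w0).
have A0 : 0 <= wmeas w A by apply: (wmeas_ge0 w0).
have mDf := measurable_distr_set mD (k.+1%:R * e)%R mf.
rewrite (_ : A `&` _ = A `&` (D `&` [set x | k.+1%:R * e < `|f x|]%R)); last first.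
  apply/seteqP; split=> x.
    by move=> [Ax /=]; rewrite lte_fin => sx; split=> //; split=> //; exact: AD.
  by move=> [Ax [_ /=]]; rewrite -lte_fin; split.
rewrite itv0I integral_itv0_cst ?le_min ?A0 //.
rewrite mul1e le_min; apply/andP; split.
  by apply: (wmeas_le mD w0 mw) => //; exact: measurableI.
by apply: (wmeas_le mD w0 mw) => //; exact: measurableI.
Qed.

(** Only [f] is cut into layers; on each superlevel set of [f] the version for sets is applied to
    [g]. *)
Lemma hardy_littlewood (f g : R -> R) : L0 D f -> L0 D g ->
  \int[leb]_(x in (D : set T)) (`|f x| * `|g x| * w x)%:E <=
  \int[leb]_(t in (itv0 (wmeas w D) : set T))
    (rearr (wmeas w) D f t * rearr (wmeas w) D g t).
Proof.
move=> mf mg.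
have mf' : measurable_fun (D : set T) (fun x => `|f x|%:E).
  exact: L0_EFin (L0_norm mf).
have mgw : measurable_fun (D : set T) (fun x => (`|g x| * w x)%:E).
  exact: L0_EFin (L0M (L0_norm mg) mw).
under eq_integral do rewrite -mulrA EFinM.
apply: (@le_layer _ T R leb D mD _ _ mf' mgw) => //.
  by move=> x Dx; rewrite lee_fin mulr_ge0 ?w0.
move=> e K e0.
apply: le_trans (@layer_le _ T R leb _ (measurable_itv0 (wmeas w D))
  (rearr (wmeas w) D f) (rearr (wmeas w) D g)
  (@measurable_rearr _ _ _ _ _) (@measurable_rearr _ _ _ _ _)
  (fun _ _ => rearr_ge0 _ _ _ _) (fun _ _ => rearr_ge0 _ _ _ _) e K (ltW e0)).
apply: lee_sum => k _; apply: lee_wpmul2l; first by rewrite lee_fin ltW.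
have s0 : (0 <= k.+1%:R * e)%R by rewrite mulr_ge0 // ltW.
rewrite level_rearr // itv0I min_r; last exact: distr_le_wmeas.
rewrite (_ : D `&` _ = D `&` [set x | k.+1%:R * e < `|f x|]%R); last first.
  by apply/funext => x /=; rewrite lte_fin.
by apply: hardy_littlewood_set => //; exact: measurable_distr_set.
Qed.

End hardy_littlewood.

(** * Primitives of nonincreasing functions *)

Section concave_primitive.
Context {R : realType}.
Local Notation T := (lebesgueType R).
Variables (a : \bar R) (phi : R -> \bar R).
Local Notation I := (itv0 a).
Hypotheses (phi0 : forall x, I x -> (0 <= phi x)%E)
  (phid : {in I &, {homo phi : x y / x <= y >-> (y <= x)%E}})
  (phifin : forall t, I t ->
    (\int[leb]_(x in (itv0 t%:E : set T)) phi x < +oo)%E).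

Definition primitive (h : R -> \bar R) (t : R) : R :=
  fine (\int[leb]_(x in (itv0 t%:E : set T)) h x).
Local Notation P := (primitive phi).

Lemma itv0_le t s : I t -> 0 < s -> s <= t -> I s.
Proof. by move=> [_ ta] s0 st; split=> //; apply: le_lt_trans ta; rewrite lee_fin. Qed.

Lemma sub_itv0 t : I t -> itv0 t%:E `<=` I.
Proof. by move=> [_ ta]; apply: subset_itv0; exact: ltW. Qed.

Let mphi : measurable_fun (I : set T) phi.
Proof. exact: nonincreasing_emeasurable. Qed.

Lemma primitive_nonpos h t : t <= 0 -> primitive h t = 0.
Proof.
move=> t0; rewrite /primitive (_ : itv0 _ = set0) ?integral_set0 //.
apply/seteqP; split=> // x [x0]; rewrite lte_fin => xt.
by have := lt_trans x0 xt; rewrite ltNge t0.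
Qed.

Lemma primitive_ge0 t : (t%:E < a)%E -> 0 <= P t.
Proof.
move=> ta; apply/fine_ge0/integral_ge0 => x [x0 xt].
by apply: phi0; split=> //; exact: lt_trans ta.
Qed.

Lemma primitiveK t : (t%:E < a)%E ->
  (\int[leb]_(x in (itv0 t%:E : set T)) phi x = (P t)%:E)%E.
Proof.
move=> ta; rewrite fineK //; have [t0|t0] := ltP 0 t.
  rewrite ge0_fin_numE; first exact: phifin.
  by apply: integral_ge0 => x /sub_itv0 xI; apply: phi0; exact: xI.
rewrite (_ : itv0 _ = set0) ?integral_set0 //.
apply/seteqP; split=> // x [x0]; rewrite lte_fin => xt.
by have := lt_trans x0 xt; rewrite ltNge t0.
Qed.

Lemma integral_itv0D (h : R -> \bar R) s t : 0 <= s -> s <= t ->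
  measurable_fun (itv0 t%:E : set T) h ->
  (forall x, itv0 t%:E x -> 0 <= h x)%E ->
  (\int[leb]_(x in (itv0 t%:E : set T)) h x =
   \int[leb]_(x in (itv0 s%:E : set T)) h x +
   \int[leb]_(x in (itv0 t%:E `\` itv0 s%:E : set T)) h x)%E.
Proof.
move=> s0 st mh h0.
have st' : itv0 s%:E `<=` itv0 t%:E by apply: subset_itv0; rewrite lee_fin.
rewrite -[in LHS](setDUK st') (@ge0_integral_setU _ T R leb) //.
- exact: measurable_itv0.
- by apply: measurableD; exact: measurable_itv0.
- by rewrite setDUK.
- by rewrite setDUK.
- by rewrite disj_set2E setDIK.
Qed.

Lemma integral_itv0D_cst (r s t : R) : 0 <= r -> 0 <= s -> s <= t ->
  (\int[leb]_(x in (itv0 t%:E `\` itv0 s%:E : set T)) r%:E = (r * (t - s))%:E)%E.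
Proof.
move=> r0 s0 st.
have := @integral_itv0D (fun=> r%:E) s t s0 st (@measurable_cst _ _ _ _ _ _)
  (fun _ _ => r0).
rewrite !integral_itv0_cst ?lee_fin ?(le_trans s0) // => /eqP.
rewrite -!EFinM addeC -sube_eq //= => [/eqP <-|].
  by rewrite -EFinB mulrBr.
by rewrite fin_num_adde_defl.
Qed.

Let mD s t : measurable (itv0 t%:E `\` itv0 s%:E : set T).
Proof. by apply: measurableD; exact: measurable_itv0. Qed.

Lemma phi_fin t : I t -> phi t \is a fin_num.
Proof.
move=> It; rewrite ge0_fin_numE ?phi0 // ltey; apply/eqP => phit.
have := phifin It; apply/negP; rewrite -leNgt.
have t0 : 0 < t by case: It.
have <- : (\int[leb]_(x in (itv0 t%:E : set T)) +oo = +oo)%E.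
  rewrite (@integral_cst _ T R leb _ (measurable_itv0 t%:E)).
  have lt : leb (itv0 t%:E : set T) = t%:E by apply: leb_itv0; rewrite lee_fin ltW.
  by rewrite -[RHS](gt0_mulye (x := t%:E)) ?lte_fin //; congr (_ * _)%E.
apply: (@ge0_le_integral _ T R leb _ (measurable_itv0 t%:E) (fun=> +oo%E) phi) => //.
- by apply: measurable_funS mphi => //; [exact: measurable_itv0|exact: sub_itv0].
- move=> x xt; rewrite -phit; apply: phid; rewrite ?inE //; first exact: sub_itv0 xt.
  by case: xt => _; rewrite lte_fin => /ltW.
Qed.

Lemma primitive_lbound s t : I t -> 0 <= s -> s <= t ->
  fine (phi t) * (t - s) <= P t - P s.
Proof.
move=> It s0 st; have [t0 ta] := It.
have sa : (s%:E < a)%E by apply: le_lt_trans ta; rewrite lee_fin.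
have mt : measurable_fun (itv0 t%:E : set T) phi.
  by apply: measurable_funS mphi => //; [exact: measurable_itv0|exact: sub_itv0].
have pt x : itv0 t%:E x -> (0 <= phi x)%E by move=> /(sub_itv0 It); exact: phi0.
have := integral_itv0D s0 st mt pt.
rewrite !primitiveK // => PtE; rewrite lerBrDl -lee_fin EFinD PtE.
apply: leeD => //; rewrite -integral_itv0D_cst //; last exact/fine_ge0/phi0.
apply: (@ge0_le_integral _ T R leb _ (mD s t)) => //.
- by move=> x _; rewrite lee_fin; exact/fine_ge0/phi0.
- by apply: measurable_funS mt => //; exact: measurable_itv0.
- move=> x [xt _]; rewrite fineK ?phi_fin //.
  apply: phid; rewrite ?inE //; first exact: sub_itv0 xt.
  by case: xt => _; rewrite lte_fin => /ltW.
Qed.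

Lemma primitive_ubound s t : I t -> 0 < s -> s <= t ->
  P t - P s <= fine (phi s) * (t - s).
Proof.
move=> It s0 st; have [t0 ta] := It.
have Is : I s by exact: itv0_le It s0 st.
have mt : measurable_fun (itv0 t%:E : set T) phi.
  by apply: measurable_funS mphi => //; [exact: measurable_itv0|exact: sub_itv0].
have pt x : itv0 t%:E x -> (0 <= phi x)%E by move=> /(sub_itv0 It); exact: phi0.
have := integral_itv0D (ltW s0) st mt pt.
rewrite !primitiveK //; last by case: Is.
move=> PtE; rewrite lerBlDl -lee_fin EFinD PtE.
apply: leeD => //; rewrite -integral_itv0D_cst //;
  [|exact/fine_ge0/phi0|exact: ltW].
apply: (@ge0_le_integral _ T R leb _ (mD s t)) => //.
- by move=> x [xt _]; exact: pt.
- by apply: measurable_funS mt => //; exact: measurable_itv0.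
- move=> x [[x0 xt] xs]; rewrite fineK ?phi_fin //.
  apply: phid; rewrite ?inE //.
    by apply: itv0_le It _ _ => //; rewrite ltW.
  by rewrite leNgt; apply/negP => xs'; apply: xs; split.
Qed.

Lemma primitive_homo s t : (t%:E < a)%E -> s <= t -> P s <= P t.
Proof.
move=> ta st; have [t0|t0] := ltP 0 t; last first.
  by rewrite !primitive_nonpos // (le_trans st).
have [s0|s0] := ltP 0 s; last first.
  by rewrite primitive_nonpos // primitive_ge0.
have It : I t by split.
rewrite -subr_ge0; apply: le_trans (primitive_lbound It (ltW s0) st).
by rewrite mulr_ge0 ?subr_ge0 //; exact/fine_ge0/phi0.
Qed.

(** Concavity: [phi x] is at most the slope of the chord over [(s, x)] and at least that over
    [(x, t)]. *)
Lemma primitive_chord s x t : I t -> 0 <= s -> s <= x -> x <= t ->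
  (P t - P s) * (x - s) <= (P x - P s) * (t - s).
Proof.
move=> It s0 sx xt; have [->|xs] := eqVneq x s.
  by rewrite !subrr mulr0 mul0r.
have x0 : 0 < x by rewrite (le_lt_trans s0) // lt_neqAle eq_sym xs.
have Ix : I x by exact: itv0_le It _ _.
have h1 := primitive_lbound Ix s0 sx.
have h2 := primitive_ubound It x0 xt.
have p0 : 0 <= fine (phi x) by exact/fine_ge0/phi0.
nra.
Qed.

(** Near 0 no slope bound is available, as [phi] may be unbounded. If [P] stayed above [e], the
    integrals over [(0, t)] minus [(0, t/(n+1))] would all be at most [P t - e], although they
    increase to [P t]. *)
Lemma primitive_small e t : I t -> 0 < e -> exists2 z, 0 < z <= t & P z < e.
Proof.
move=> It e0; apply: contrapT => nz; have [t0 ta] := It.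
have tn n : 0 < t / n.+1%:R by rewrite divr_gt0.
have tnt n : t / n.+1%:R <= t.
  by rewrite ler_pdivrMr // ler_peMr ?ler1n // ltW.
have Pn n : e <= P (t / n.+1%:R).
  rewrite leNgt; apply/negP => Pe; apply: nz; exists (t / n.+1%:R) => //.
  by rewrite tn tnt.
have mt : measurable_fun (itv0 t%:E : set T) phi.
  by apply: measurable_funS mphi => //; [exact: measurable_itv0|exact: sub_itv0].
have pt x : itv0 t%:E x -> (0 <= phi x)%E by move=> /(sub_itv0 It); exact: phi0.
pose F n : set T := itv0 t%:E `\` itv0 (t / n.+1%:R)%:E.
have mF n : measurable (F n) by exact: mD.
have FE : \bigcup_n F n = itv0 t%:E.
  apply/seteqP; split=> x; first by move=> [n _ []].
  move=> [x0 xt]; exists (Num.bound (t / x)) => //; split; first by split.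
  move=> [_]; rewrite lte_fin ltr_pdivlMr // mulrC -ltr_pdivlMr //.
  apply/negP; rewrite -leNgt; apply/ltW.
  apply: lt_le_trans (archi_boundP _) _; first by rewrite divr_ge0 ?ltW.
  by rewrite ler_nat.
have ndF : nondecreasing_seq F.
  move=> m n mn; rewrite subsetEset => x [xt xm]; split=> //.
  apply: contra_not xm => -[x0 xn]; split=> //; apply: lt_le_trans xn _.
  by rewrite lee_fin ler_pM2l // lef_pV2 ?posrE ?ltr0n // ler_nat.
have cvgF := @ge0_nondecreasing_set_cvg_integral _ T R F phi leb ndF mF
  (fun i => measurable_funS (measurable_itv0 _) (@subIsetl _ _ _) mt)
  (fun i x Fx => pt x (Fx.1)).
have : (\int[leb]_(x in (itv0 t%:E : set T)) phi x <= (P t - e)%:E)%E.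
  rewrite -{1}FE.
  have -> : (\int[leb]_(x in (\bigcup_n F n)) phi x)%E =
     limn (fun n => \int[leb]_(x in F n) phi x)%E by apply/esym/cvg_lim.
  apply: lime_le; first exact: (cvgP _ cvgF).
  apply: nearW => n.
  have := integral_itv0D (ltW (tn n)) (tnt n) mt pt.
  rewrite !primitiveK //; last by apply: le_lt_trans ta; rewrite lee_fin.
  rewrite -/(F n) => PtE.
  have Ffin : (\int[leb]_(x in F n) phi x)%E \is a fin_num.
    rewrite ge0_fin_numE; last by apply: integral_ge0 => x [/pt].
    rewrite ltey; apply/eqP => Fy; move: PtE; rewrite Fy.
    by rewrite addey.
  move: PtE; rewrite -(fineK Ffin) -EFinD lee_fin => -[PtE].
  by have := Pn n; lra.
by rewrite primitiveK // lee_fin; apply/negP; rewrite -ltNge ltrBlDr ltrDl.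
Qed.

Lemma primitive_continuous t : (t%:E < a)%E -> {for t, continuous P}.
Proof.
move=> ta; apply/cvgrPdist_le => e e0; apply/nbhs_ballP.
have [t' [tt' It']] : exists t', t < t' /\ (0 < t' -> I t').
  case: a ta => [r| |] // ta.
    rewrite lte_fin in ta; exists ((t + r) / 2); split; first by lra.
    by move=> h; split=> //; rewrite lte_fin; lra.
  by exists (t + 1); split; [lra|split => //; rewrite ltry].
have [t0|t0] := ltP 0 t; last first.
  have [tn|tp] := ltP t 0.
    exists (- t) => /=; first by rewrite oppr_gt0.
    move=> y; rewrite /ball /= ltr_distlC => /andP[_ yt].
    by rewrite !primitive_nonpos ?subrr ?normr0 ?(ltW e0) //; lra.
  have {tp}t0 : t = 0 by apply: le_anti; rewrite t0 tp.
  subst t; have It := It' tt'.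
  have [z /andP[z0 zt'] Pz] := primitive_small It e0.
  exists z => //= y; rewrite /ball /= ltr_distlC => /andP[_ yz].
  have Iz : I z by exact: itv0_le It _ _.
  rewrite primitive_nonpos // sub0r normrN ger0_norm.
    apply: ltW; apply: le_lt_trans Pz; apply: primitive_homo; first by case: Iz.
    by lra.
  by apply: primitive_ge0; case: Iz => _; apply: le_lt_trans; rewrite lee_fin; lra.
have It : I t by split.
have Ih : I (t / 2) by apply: itv0_le It _ _; lra.
(* On [[t / 2, t']] all slopes are at most the value of [phi] at the left end, so [P] is Lipschitz
   there. The radius below uses [c + 1] because [c] may be 0. *)
set c := fine (phi (t / 2)).
have c0 : 0 <= c by exact/fine_ge0/phi0.
have lip x y : t / 2 <= x -> x <= y -> y <= t' -> `|P y - P x| <= c * (y - x).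
  move=> tx xy yt'.
  have x0 : 0 < x by lra.
  have Iy : I y by apply: (itv0_le (It' _)) => //; lra.
  have Ix : I x by exact: itv0_le Iy _ _.
  rewrite ger0_norm ?subr_ge0; last by apply: primitive_homo => //; case: Iy.
  apply: le_trans (primitive_ubound Iy x0 xy) _.
  rewrite ler_wpM2r ?subr_ge0 // /c fine_le ?phi_fin //.
  by apply: phid; rewrite ?inE.
exists (Num.min (t / 2) (Num.min (t' - t) (e / (c + 1)))) => /=.
  by rewrite !lt_min divr_gt0 //= subr_gt0 tt' /= divr_gt0 // ltr_wpDl.
move=> y; rewrite /ball /= !lt_min => /and3P[y1 y2 y3].
have ce : c * `|t - y| <= e.
  apply: le_trans (_ : (c + 1) * `|t - y| <= _).
    by rewrite ler_wpM2r // lerDl.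
  by rewrite mulrC -ler_pdivlMr ?ltr_wpDl // ltW.
move: y1 y2; rewrite !ltr_distlC => /andP[ya yb] /andP[yc yd].
apply: le_trans ce.
have [ty|/ltW ty] := leP t y.
  have := lip t y; rewrite [`|t - y|]distrC [`|y - t|]ger0_norm ?subr_ge0 //.
  by rewrite distrC; apply; lra.
have := lip y t; rewrite [`|t - y|]ger0_norm ?subr_ge0 //; apply; lra.
Qed.

End concave_primitive.

(** * The level function of [F] relative to [W] *)

Section level_function.
Context {R : realType}.
Variables (a : \bar R) (F W : R -> R).
Local Notation I := (itv0 a).
Hypotheses (F0 : F 0 = 0) (W0 : W 0 = 0)
  (F_homo : forall s t : R, (t%:E < a)%E -> s <= t -> F s <= F t)
  (W_incr : forall s t : R, I t -> 0 <= s -> s < t -> W s < W t)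
  (F_cont : forall t : R, (t%:E < a)%E -> {for t, continuous F})
  (W_cont : forall t : R, (t%:E < a)%E -> {for t, continuous W})
  (FW_bounded : forall x, I x -> exists C, forall y, I y -> x < y ->
     F y <= C * W y).

(** The chord condition is multiplied out; [z <= x < y] makes the increment of [W] positive, so this
    is the usual slope inequality. For [x] in [I] the slope 0 always qualifies, [F] being monotone,
    so the supremum is over a non-empty set. *)
Definition level_slopes x : set R :=
  [set s | 0 <= s /\ exists2 y, I y /\ x < y &
    forall z, 0 <= z -> z <= x -> s * (W y - W z) <= F y - F z].

(* The slope at [x] of the least majorant of [F] which is concave with respect
   to [W], by the max-min formula [sup_(x < y) inf_(z <= x)] of the chords of
   [F] over those of [W]. *)
Definition level_fun x : R := sup (level_slopes x).

Let W_homo s t : I t -> 0 <= s -> s <= t -> W s <= W t.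
Proof.
move=> It s0; rewrite le_eqVlt => /predU1P[->//|st].
exact/ltW/W_incr.
Qed.

Let W_gt0 t : I t -> 0 < W t.
Proof. by move=> It; rewrite -W0; apply: W_incr => //; case: It. Qed.

Let next x : I x -> exists2 y, I y & x < y.
Proof.
move=> [x0]; case: a => [r| |] //.
  rewrite lte_fin => xr; exists ((x + r) / 2); last by lra.
  by split; rewrite ?lte_fin; lra.
by move=> _; exists (x + 1); [split; rewrite ?ltry //; lra|lra].
Qed.

Let slopes0 x : I x -> level_slopes x 0.
Proof.
move=> Ix; split=> //; have [y Iy xy] := next Ix; exists y => // z z0 zx.
rewrite mul0r subr_ge0; apply: F_homo; first by case: Iy.
by rewrite (le_trans zx) // ltW.
Qed.

Let slopes_ub x : I x -> has_ubound (level_slopes x).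
Proof.
move=> Ix; have [C FC] := FW_bounded Ix; exists C => s [s0 [y [Iy xy] sy]].
have x0 : 0 <= x by case: Ix => /ltW.
have := sy 0 (lexx 0) x0; rewrite W0 F0 !subr0 => h.
by rewrite -(ler_pM2r (W_gt0 Iy)); apply: le_trans h _; exact: FC.
Qed.

Lemma level_fun_ge x s : I x -> level_slopes x s -> s <= level_fun x.
Proof. by move=> Ix; apply: ub_le_sup; exact: slopes_ub. Qed.

Lemma level_fun_ge0 x : I x -> 0 <= level_fun x.
Proof. by move=> Ix; apply: level_fun_ge => //; exact: slopes0. Qed.

Lemma level_fun_gt x s : I x -> 0 <= s -> s < level_fun x -> level_slopes x s.
Proof.
move=> Ix s0 sL.
have [|t [t0 [y [Iy xy] ty]] st] :=
  @sup_gt _ (level_slopes x) s _ sL; first by exists 0; exact: slopes0.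
split=> //; exists y => // z z0 zx; apply: le_trans (ty _ z0 zx).
rewrite ler_wpM2r ?ltW // subr_gt0; apply: W_incr => //.
exact: le_lt_trans xy.
Qed.

Lemma level_fun_anti : {in I &, {homo level_fun : x y / x <= y >-> y <= x}}.
Proof.
move=> x y; rewrite !inE => Ix Iy xy; apply: ge_sup; first by exists 0; exact: slopes0.
move=> s [s0 [u [Iu yu] us]]; apply: level_fun_ge => //; split=> //.
exists u; first by split=> //; exact: le_lt_trans xy yu.
by move=> z z0 zx; apply: us => //; exact: le_trans xy.
Qed.

Let argmax x s : I x -> exists2 m, 0 <= m <= x &
  forall z, 0 <= z <= x -> F z - s * W z <= F m - s * W m.
Proof.
move=> [x0 xa].
have [|m m0 mmax] := @EVT_max R (fun z => F z - s * W z) 0 x (ltW x0).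
  apply: continuous_in_subspaceT => z; rewrite inE /= in_itv /= => /andP[_ zx].
  have za : (z%:E < a)%E by apply: le_lt_trans xa; rewrite lee_fin.
  apply: cvgB; first exact: F_cont.
  by apply: cvgM; [exact: cvg_cst|exact: W_cont].
exists m; first by move: m0; rewrite in_itv.
by move=> z z0; apply: mmax; rewrite in_itv.
Qed.

(** [m k] maximizes [F - k e W] on [[0, x]]. It is then a witness [y] for the slope [k e] at every
    [z < m k]. Raising the slope by [e] lowers the maximum by at most [e * W (m k)]; starting from
    slope 0, whose maximum is at least [F x], these losses add up to the stated sum. *)
Lemma level_fun_steps x e K : I x -> 0 < e -> exists m : nat -> R,
  [/\ forall k, 0 <= m k <= x,
      forall k z, 0 < z < m k -> k%:R * e <= level_fun z &
      F x <= \sum_(k < K) e * W (m k) + (F (m K) - K%:R * e * W (m K))].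
Proof.
move=> Ix e0; have [x0 xa] := Ix.
pose m k := projT1 (cid2 (argmax (k%:R * e) Ix)).
have mx k : 0 <= m k <= x by rewrite /m; case: cid2.
have mmax k z : 0 <= z <= x ->
    F z - k%:R * e * W z <= F (m k) - k%:R * e * W (m k).
  by rewrite /m; case: cid2 => ? ?; apply.
exists m; split=> //.
  move=> k z /andP[z0 zm]; have /andP[m0 mxk] := mx k.
  have Im : I (m k).
    split; first exact: lt_trans zm.
    by apply: le_lt_trans xa; rewrite lee_fin.
  apply: level_fun_ge.
    by split=> //; apply: lt_trans (Im.2); rewrite lte_fin.
  split; first by rewrite mulr_ge0 // ltW.
  exists (m k) => // u u0 uz.
  have := mmax k u; rewrite u0 (le_trans uz) ?(le_trans (ltW zm)) // => /(_ isT).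
  by rewrite mulrBr; lra.
elim: K => [|K ih].
  rewrite big_ord0 add0r; have := mmax 0%N x.
  by rewrite lexx ltW // mul0r !mul0r !subr0 => /(_ isT).
apply: le_trans ih _; rewrite big_ord_recr /= -addrA lerD2l.
have := mmax K.+1 (m K) (mx K); rewrite -natr1 !mulrDl !mul1r; lra.
Qed.

(** Each [p k] yields a point [y k] beyond it where [F - s k W] is at least its values on
    [[0, p k]]. Choosing maximizers among these finitely many points avoids maximizing over all of
    [I], which is not compact. *)
Lemma level_fun_chain (e : R) K (p : nat -> R) : 0 < e ->
  (forall k, (k < K)%N -> I (p k) /\ k.+1%:R * e < level_fun (p k)) ->
  exists m : nat -> R,
  [/\ forall k, (k < K)%N -> I (m k) /\ p k <= m k,
      forall k, (K <= k)%N -> m k = 0,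
      forall k, m k.+1 <= m k &
      forall k, (k < K)%N ->
        k.+1%:R * e * (W (m k) - W (m k.+1)) <= F (m k) - F (m k.+1)].
Proof.
move=> e0 pL; pose s k : R := k.+1%:R * e.
have s0 k : 0 <= s k by rewrite mulr_ge0 // ltW.
have yP (k : 'I_K) : exists y, [/\ I y, p k < y &
    forall z, 0 <= z -> z <= p k -> s k * (W y - W z) <= F y - F z].
  have [Ip sL] := pL k (ltn_ord k).
  by have [_ [y [Iy py] yP]] := level_fun_gt Ip (s0 k) sL; exists y.
pose y k := projT1 (cid (yP k)).
have Iy (k : 'I_K) : I (y k) by rewrite /y; case: cid => ? [].
have py (k : 'I_K) : p k < y k by rewrite /y; case: cid => ? [].
have ymax (k : 'I_K) z : 0 <= z -> z <= p k ->
    F z - s k * W z <= F (y k) - s k * W (y k).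
  rewrite /y; case: cid => /= u [_ _ uP] z0 zp.
  by have := uP z z0 zp; rewrite mulrBr; lra.
(* The constraint [p k <= y i] costs nothing: a candidate below [p k] is dominated by [y k]. So the
   choice is optimal among all candidates. *)
pose j (k : 'I_K) := [arg max_(i > k | p k <= y i) (F (y i) - s k * W (y i))]%O.
have jP (k : 'I_K) : p k <= y (j k) /\
    forall i, F (y i) - s k * W (y i) <= F (y (j k)) - s k * W (y (j k)).
  rewrite /j; case: arg_maxP => [|i pi imax]; first exact/ltW/py.
  split=> // l; have [pl|/ltW lp] := leP (p k) (y l); first exact: imax.
  apply: le_trans (ymax k (y l) _ lp) _; first by case: (Iy l) => /ltW.
  by apply: imax; exact/ltW/py.
(* The default 0 closes the chain at the origin, where [F] and [W] vanish. *)
pose m k := if insub k is Some i then y (j i) else 0.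
have mE k (kK : (k < K)%N) : m k = y (j (Ordinal kK)).
  by rewrite /m insubT.
have m0 k : (K <= k)%N -> m k = 0.
  by move=> Kk; rewrite /m insubF // ltnNge Kk.
have key k : (k < K)%N -> F (m k.+1) - s k * W (m k.+1) <= F (m k) - s k * W (m k).
  move=> kK; rewrite (mE _ kK); have [k1K|k1K] := ltnP k.+1 K.
    by rewrite (mE _ k1K); exact: (jP (Ordinal kK)).2.
  rewrite m0 // F0 W0 mulr0 subr0.
  apply: le_trans ((jP (Ordinal kK)).2 (Ordinal kK)).
  have := ymax (Ordinal kK) 0 (lexx 0); rewrite F0 W0 mulr0 subr0; apply.
  by case: (pL _ kK) => -[/ltW].
exists m; split=> //.
- by move=> k kK; rewrite (mE _ kK); split=> //; exact: (jP (Ordinal kK)).1.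
- move=> k; have [k1K|k1K] := ltnP k.+1 K; last first.
    rewrite (m0 k.+1) //; have [kK|kK] := ltnP k K; last by rewrite m0.
    by rewrite (mE _ kK); case: (Iy (j (Ordinal kK))) => /ltW.
  have kK : (k < K)%N by exact: ltnW.
  have h1 := key _ kK.
  have h2 : F (m k) - s k.+1 * W (m k) <= F (m k.+1) - s k.+1 * W (m k.+1).
    by rewrite (mE _ k1K) (mE _ kK); exact: (jP (Ordinal k1K)).2.
  (* Adding optimality of [m k] at [s k] and of [m k.+1] at the larger [s k.+1] gives
     [W (m k.+1) <= W (m k)]. As the levels differ and [W] increases strictly, ties between
     maximizers are harmless. *)
  rewrite leNgt; apply/negP => mk.
  have : W (m k) < W (m k.+1).
    apply: W_incr => //; first by rewrite (mE _ k1K).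
    by rewrite (mE _ kK); case: (Iy (j (Ordinal kK))) => /ltW.
  move: h1 h2; rewrite /s -(natr1 k.+1) !mulrDl !mul1r; nra.
- by move=> k kK; have := key _ kK; rewrite /s mulrBr; lra.
Qed.

End level_function.

(** * Summation by parts and averages over intervals *)

Lemma abel_summation (R : comRingType) (g x : nat -> R) n : g 0%N = 0 ->
  \sum_(k < n) g k.+1 * (x k - x k.+1) =
  \sum_(k < n) (g k.+1 - g k) * x k - g n * x n.
Proof.
move=> g0; elim: n => [|n ih]; first by rewrite !big_ord0 g0 mul0r subr0.
by rewrite !big_ord_recr /= ih; ring.
Qed.

Section averaging.
Context {R : realFieldType}.
Variables (J : set R) (U v : R -> R).
Hypotheses (J_gt0 : forall t, J t -> 0 < t)
  (U0 : U 0 = 0) (v0 : forall t, J t -> 0 <= v t)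
  (U_homo : forall s t : R, J t -> s <= t -> U s <= U t)
  (U_lbound : forall s t : R, J t -> 0 <= s -> s <= t -> v t * (t - s) <= U t - U s)
  (U_ubound : forall s t : R, J t -> 0 < s -> s <= t -> U t - U s <= v s * (t - s))
  (U_chord : forall s x t : R, J t -> 0 <= s -> s <= x -> x <= t ->
     (U t - U s) * (x - s) <= (U x - U s) * (t - s)).
Variables (K : nat) (y : nat -> R).
Hypotheses (yJ : forall k, (k < K)%N -> J (y k))
  (y0 : forall k, (K <= k)%N -> y k = 0) (y_anti : forall k, y k.+1 <= y k).

(* The step function [\sum_k c_k 1_(0, y_k)] averages [v] over each interval
   between consecutive [y_k]; empty intervals get the value of [v] so that the
   averages stay monotone. *)
Let avg k := if y k.+1 < y k then (U (y k) - U (y k.+1)) / (y k - y k.+1)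
             else v (y k).

Let y_ge0 k : 0 <= y k.
Proof. by have [/yJ/J_gt0/ltW//|/y0->] := ltnP k K. Qed.

Let avgE k : avg k * (y k - y k.+1) = U (y k) - U (y k.+1).
Proof.
rewrite /avg; case: ifPn => [yk|]; first by rewrite divfK // subr_eq0 gt_eqF.
rewrite -leNgt => yk; have -> : y k.+1 = y k by apply: le_anti; rewrite yk y_anti.
by rewrite !subrr mulr0.
Qed.

Let v_le_avg k : (k < K)%N -> v (y k) <= avg k.
Proof.
move=> kK; rewrite /avg; case: ifPn => // yk.
by rewrite ler_pdivlMr ?subr_gt0 //; apply: U_lbound; [exact: yJ|exact: y_ge0|exact: y_anti].
Qed.

Let avg_le_v k : (k.+1 < K)%N -> avg k <= v (y k.+1).
Proof.
move=> kK; rewrite /avg; case: ifPn => [yk|].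
  rewrite ler_pdivrMr ?subr_gt0 //; apply: U_ubound;
    [exact/yJ/ltnW|exact/J_gt0/yJ|exact: y_anti].
rewrite -leNgt => yk; have -> // : y k.+1 = y k by apply: le_anti; rewrite yk y_anti.
Qed.

(** The [c k] are the jumps of the averages, so the step function equals [avg k] between [y k.+1]
    and [y k]. They are nonnegative because a value of [v] at each [y k] separates neighbouring
    averages. The second clause is concavity of [U], which lies above its chords; the third is
    summation by parts on both sides. *)
Lemma average_step : exists c : nat -> R,
  [/\ forall k, (k < K)%N -> 0 <= c k,
      forall x, 0 <= x -> J x -> \sum_(k < K) c k * Num.min x (y k) <= U x &
      forall (e : R) (f : nat -> R), 0 <= e -> f K = 0 ->
        (forall k, (k < K)%N -> k.+1%:R * e * (y k - y k.+1) <= f k - f k.+1) ->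
        \sum_(k < K) e * U (y k) <= \sum_(k < K) c k * f k].
Proof.
pose g k := if k is l.+1 then avg l else 0.
exists (fun k => g k.+1 - g k); split.
- move=> [|k] kK; rewrite subr_ge0 /=.
    by apply: le_trans (v_le_avg kK); apply: v0; exact: yJ.
  by apply: le_trans (avg_le_v kK) _; exact: v_le_avg.
- move=> x x0 Jx; pose z k := Num.min x (y k).
  have zK : z K = 0 by rewrite /z y0 // min_r.
  have := @abel_summation _ g z K erefl.
  rewrite zK mulr0 subr0 => <-.
  apply: (@le_trans _ _ (\sum_(k < K) (U (z k) - U (z k.+1)))).
    apply: ler_sum => -[k kK] _ /=; rewrite /z.
    have yk := y_anti k; have := y_ge0 k.+1 => yk0.
    (* Only the interval containing [x] needs the chord inequality: those to its right contribute
       nothing, those to its left give equality. *)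
    have [xk1|xk1] := leP x (y k.+1).
      by rewrite min_l ?(le_trans xk1) // !subrr mulr0.
    have [xk|xk] := leP x (y k); last by rewrite avgE.
    have ykk : y k.+1 < y k by exact: lt_le_trans xk.
    rewrite /avg ykk mulrAC ler_pdivrMr ?subr_gt0 //.
    by apply: U_chord => //; [exact: yJ|exact: ltW].
  have -> : \sum_(k < K) (U (z k) - U (z k.+1)) = U (z 0%N) - U (z K).
    elim: K => [|n ih]; first by rewrite big_ord0 subrr.
    by rewrite big_ord_recr /= ih; ring.
  by rewrite zK U0 subr0; apply: U_homo => //; rewrite /z ge_min lexx.
- move=> e f e0 fK fk.
  have := @abel_summation _ g f K erefl; rewrite fK mulr0 subr0 => <-.
  (* Heights [k * e] have all jumps equal to [e]. The sum becomes one over increments of [U], each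
     equal to [avg k] times a length, and the assumption on [f] applies term by term. *)
  have := @abel_summation _ (fun k => k%:R * e) (U \o y) K (mul0r _).
  rewrite /= y0 // U0 mulr0 subr0.
  rewrite [X in _ = X -> _](_ : _ = \sum_(k < K) e * U (y k)); last first.
    by apply: eq_bigr => k _; rewrite -natr1; ring.
  move=> <-; apply: ler_sum => -[k kK] _ /=.
  rewrite -avgE mulrCA; apply: ler_wpM2l; last exact: fk.
  by apply: le_trans (v_le_avg kK); apply: v0; exact: yJ.
Qed.

End averaging.

(** * Attaining rearranged pairings on sets of prescribed measure *)

Section resonance.
Context {R : realType}.
Local Notation T := (lebesgueType R).

Lemma integral_step (D : set T) (phi : R -> \bar R) n (c : nat -> R)
    (A : nat -> set R) :
  measurable D -> measurable_fun D phi -> (forall x, D x -> 0 <= phi x)%E ->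
  (forall k, (k < n)%N -> 0 <= c k) ->
  (forall k, (k < n)%N -> measurable (A k : set T)) ->
  (\int[leb]_(x in D) (phi x * (\sum_(k < n) c k * \1_(A k) x)%:E) =
   \sum_(k < n) (c k)%:E * \int[leb]_(x in D `&` A k) phi x)%E.
Proof.
move=> mD mphi phi0 c0 mA.
have mp (k : 'I_n) : measurable_fun D (phi \_ (A k)).
  apply/measurable_restrict => //; first exact: mA.
  apply: measurable_funS mphi => //.
have p0 (k : 'I_n) x : D x -> (0 <= (phi \_ (A k)) x)%E.
  by move=> Dx; rewrite patchE; case: ifP => // _; exact: phi0.
transitivity (\int[leb]_(x in D)
    (\sum_(k < n) (c k)%:E * (phi \_ (A k)) x))%E.
  apply: eq_integral => x; rewrite inE => Dx.
  rewrite -sumEFin muleC ge0_sume_distrl; last first.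
    by move=> k _; rewrite lee_fin mulr_ge0 ?c0.
  apply: eq_bigr => k _; rewrite patchE indicE; case: ifP => _ /=.
    by rewrite mulr1.
  by rewrite mulr0 mul0e mule0.
rewrite (@ge0_integral_sum _ T R leb D mD 'I_n
  (fun k x => (c k)%:E * (phi \_ (A k)) x)%E).
- apply: eq_bigr => k _; rewrite (@ge0_integralZl_EFin _ T R leb D mD) ?c0 //.
    by rewrite -integral_mkcondr.
  by move=> x; exact: p0.
- by move=> k; exact: measurable_funeM.
- by move=> k x Dx; rewrite mule_ge0 ?lee_fin ?c0 ?p0.
Qed.

Lemma leb_itv0D (s t : R) : s <= t -> (leb (itv0 t%:E `\` itv0 s%:E : set T) <= (t - s)%:E)%E.
Proof.
move=> st; apply: (@le_trans _ _ (leb (`[s, t] : set T))).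
  apply: le_measure; rewrite ?inE.
  - by apply: measurableD; exact: measurable_itv0.
  - exact: measurable_itvT.
  - move=> x [[x0 xt] xs]; rewrite /= in_itv /=; apply/andP; split; last exact: ltW.
    by rewrite leNgt; apply/negP => xs'; apply: xs; split.
rewrite [leLHS](_ : _ = lebesgue_measure (`[s, t]%classic : set R)) //.
rewrite lebesgue_measure_itv /= lte_fin; case: ifP => // _.
by rewrite lee_fin subr_ge0.
Qed.

(** The measure of [X] together with the part of [Y] before [x] is a 1-Lipschitz function of [x], so
    the intermediate value theorem applies. *)
Lemma between_set (X Y : set T) (t : R) : measurable X -> measurable Y ->
  X `<=` Y -> (forall x, Y x -> 0 < x) -> (leb X <= t%:E < leb Y)%E ->
  exists x, leb (X `|` (Y `&` itv0 x%:E)) = t%:E.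
Proof.
move=> mX mY XY Y0 /andP[Xt tY].
pose S x : set T := X `|` (Y `&` itv0 x%:E).
have mS x : measurable (S x).
  by apply: measurableU => //; apply: measurableI => //; exact: measurable_itv0.
have S_homo x y : x <= y -> S x `<=` S y.
  move=> xy z [Xz|[Yz [z0 zx]]]; [by left|right; split=> //; split=> //].
  by apply: lt_le_trans zx _; rewrite lee_fin.
have S_lip x y : x <= y -> (leb (S y) <= leb (S x) + (y - x)%:E)%E.
  move=> xy; apply: le_trans (leeD (lexx _) (leb_itv0D xy)).
  apply: (@le_trans _ _ (leb (S x `|` (itv0 y%:E `\` itv0 x%:E)))); last first.
    apply: (@measureU2 _ T R leb) => //.
    by apply: measurableD; exact: measurable_itv0.
  apply: le_measure; rewrite ?inE //.
    by apply: measurableU => //; apply: measurableD; exact: measurable_itv0.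
  move=> z [Xz|[Yz zy]]; first by left; left.
  by have [zx|zx] := pselect (itv0 x%:E z); [left; right|right].
have S0 : S 0 = X.
  apply/seteqP; split=> x; last by left.
  by move=> [//|[_ [x0]]]; rewrite lte_fin => /(lt_trans x0); rewrite ltxx.
have Sfin x : leb (S x) \is a fin_num.
  rewrite ge0_fin_numE //; have [x0|x0] := leP 0 x.
    apply: le_lt_trans (S_lip 0 x x0) _; rewrite S0.
    by apply: lte_add_pinfty; rewrite ?ltry // (le_lt_trans Xt) ?ltry.
  apply: (@le_lt_trans _ _ (leb X)); last by rewrite (le_lt_trans Xt) ?ltry.
  by rewrite -S0; apply: le_measure; rewrite ?inE //; apply: S_homo; exact: ltW.
pose f x := fine (leb (S x)).
have f_lip x y : x <= y -> `|f x - f y| <= y - x.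
  move=> xy; have := S_lip x y xy.
  have : (leb (S x) <= leb (S y))%E.
    by apply: le_measure; rewrite ?inE //; exact: S_homo.
  rewrite -(fineK (Sfin x)) -(fineK (Sfin y)) -EFinD !lee_fin -/(f x) -/(f y).
  by move=> h1 h2; rewrite ler_norml; apply/andP; split; lra.
have f_cont : continuous f.
  move=> x; apply/cvgrPdist_le => e e0; apply/nbhs_ballP; exists e => //= y.
  rewrite /ball /= => /ltW; apply: le_trans.
  have [xy|/ltW xy] := leP x y.
    by apply: le_trans (f_lip _ _ xy) _; rewrite distrC ler_norm.
  by rewrite distrC; apply: le_trans (f_lip _ _ xy) _; rewrite ler_norm.
(* If the value [t] were never reached, continuity from below would bound the measure of [Y] by
   [t]. *)
have [x1 tx1] : exists n : nat, t <= f n%:R.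
  apply: contrapT => nt; move: tY; apply/negP; rewrite -leNgt.
  rewrite -(wmeas1 mY) (_ : Y = \bigcup_n S n%:R); last first.
    apply/seteqP; split=> x; last by move=> [n _ [/XY|[]]].
    move=> Yx; exists (Num.bound x) => //; right; split=> //; split; first exact: Y0.
    by rewrite lte_fin; apply: archi_boundP; apply/ltW/Y0.
  apply: (@wmeas_bigcup_le _ setT) => //.
  - exact: measurable_cst.
  - by move=> m n mn; apply: S_homo; rewrite ler_nat.
  - move=> n; rewrite wmeas1 // -(fineK (Sfin n%:R)) lee_fin leNgt.
    by apply/negP => /ltW tn; apply: nt; exists n.
have f0t : f 0 <= t.
  by rewrite /f S0 -lee_fin fineK // -S0.
have [||x _ fx] := @IVT R f 0 x1%:R t (ler0n _ _).
- exact: continuous_subspaceT.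
- by rewrite ge_min f0t /= le_max tx1 orbT.
by exists x; rewrite -fx fineK.
Qed.

(* Initial segments of the lexicographic order "level first, then position"
   form a chain to which all the levels [B k] belong. *)
Lemma nested_sets (B : nat -> set T) n : (forall k, measurable (B k)) ->
  (forall x, B 0%N x -> 0 < x) -> (forall k, B k.+1 `<=` B k) -> B n = set0 ->
  exists A : R -> set R, (forall t, 0 <= t -> (t%:E < leb (B 0%N))%E ->
    [/\ measurable (A t : set T), A t `<=` B 0%N, leb (A t : set T) = t%:E,
        (forall k, B k `<=` A t \/ A t `<=` B k) &
        forall t', t <= t' -> (t'%:E < leb (B 0%N))%E -> A t `<=` A t']).
Proof.
move=> mB B0 BS Bn.
have B_anti i j : (i <= j)%N -> B j `<=` B i.
  move=> /subnK <-; elim: (j - i)%N => [//|k ih].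
  by rewrite addSn; exact: subset_trans (BS _) ih.
pose S j (x : R) : set T := B j.+1 `|` (B j `&` itv0 x%:E).
have mS j x : measurable (S j x).
  by apply: measurableU => //; apply: measurableI => //; exact: measurable_itv0.
have SB j x : S j x `<=` B j by move=> z [/BS|[]].
have S_total i x j y : S i x `<=` S j y \/ S j y `<=` S i x.
  wlog ij : i x j y / (i <= j)%N.
    move=> h; have [ij|/ltnW ij] := leqP i j; first exact: h.
    by rewrite or_comm; exact: h.
  move: ij; rewrite leq_eqVlt => /predU1P[ij|ij]; last first.
    by right=> z /SB /(B_anti _ _ ij); left.
  subst j; wlog xy : x y / x <= y.
    move=> h; have [xy|/ltW xy] := leP x y; first exact: h.
    by rewrite or_comm; exact: h.
  left=> z [|[Bz [z0 zx]]]; [by left|right; split=> //; split=> //].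
  by apply: lt_le_trans zx _; rewrite lee_fin.
have ex t : exists X : set R, 0 <= t -> (t%:E < leb (B 0%N))%E ->
    (exists j x, X = S j x) /\ leb (X : set T) = t%:E.
  have [t0|_] := leP 0 t; last by exists set0.
  have [tB|_] := ltP t%:E (leb (B 0%N)); last by exists set0.
  (* The measure of [B 0] exceeds [t] and [B n] is empty, so some consecutive pair brackets [t]. *)
  have : exists j, (leb (B j.+1) <= t%:E < leb (B j))%E.
    apply: contrapT => nj.
    have tBj j : (t%:E < leb (B j))%E.
      elim: j => [//|j ih]; rewrite ltNge; apply/negP => h.
      by apply: nj; exists j; rewrite h.
    by have := tBj n; rewrite Bn measure0 lte_fin ltNge t0.
  move=> [j tj]; have Bj0 x : B j x -> 0 < x by move=> /(B_anti 0%N j (leq0n j)); exact: B0.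
  have [x Sx] := between_set (mB _) (mB _) (BS j) Bj0 tj.
  by exists (S j x) => _ _; split=> //; exists j, x.
pose A t := projT1 (cid (ex t)).
have AP t : 0 <= t -> (t%:E < leb (B 0%N))%E ->
    (exists j x, A t = S j x) /\ leb (A t : set T) = t%:E.
  by rewrite /A; case: cid.
exists A => t t0 tB; have [[j [x AE]] At] := AP t t0 tB; split=> //.
- by rewrite AE.
- by rewrite AE => z /SB; exact: B_anti.
- rewrite AE => k; have [kj|jk] := leqP k j.
    by right=> z /SB; exact: B_anti.
  by left=> z Bz; left; exact: B_anti Bz.
- move=> t'; rewrite le_eqVlt => /predU1P[<- _|tt' t'B].
    exact: subset_refl.
  have [[i [y AE']] At'] := AP t' (le_trans t0 (ltW tt')) t'B.
  (* The two sets are comparable, and the reverse inclusion contradicts their measures [t < t']. *)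
  have [|h] := S_total j x i y; first by rewrite AE AE'.
  have : (leb (S i y) <= leb (S j x))%E by apply: le_measure; rewrite ?inE.
  by rewrite -AE -AE' At At' lee_fin leNgt tt'.
Qed.

(** If [A k] is comparable with every superlevel set of [f] in a layer sum, each intersection has
    the smaller of the two measures, which is what the rearrangement yields on [(0, m k)]. The sets
    depend on the mesh and the number of layers, hence the bound is assumed for all admissible
    families [A]. *)
Lemma resonance (a C : \bar R) (f : R -> R) n (c m : nat -> R) :
  L0 (itv0 a) f -> (forall k, (k < n)%N -> 0 <= c k) ->
  (forall k, (k < n)%N -> itv0 a (m k)) ->
  (forall A : nat -> set R,
    (forall k, (k < n)%N -> [/\ measurable (A k : set T), A k `<=` itv0 a &
       leb (A k : set T) = (m k)%:E]) ->
    (forall k l, (k < n)%N -> (l < n)%N -> m k <= m l -> A k `<=` A l) ->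
    (\int[leb]_(x in (itv0 a : set T))
       `|f x * \sum_(k < n) c k * \1_(A k) x|%:E <= C)%E) ->
  (\sum_(k < n) (c k)%:E *
    \int[leb]_(t in (itv0 (m k)%:E : set T)) rearr leb (itv0 a) f t <= C)%E.
Proof.
(* Without any term there is no point [m k] to show [0 <= a]; the claim is then just [0 <= C]. *)
move=> mf c0 mI AC; have [n0|n0] := posnP n.
  subst n; rewrite big_ord0; apply: le_trans (AC (fun=> set0) _ _) => //.
  exact: integral_ge0.
have a0 : (0 <= a)%E.
  by have [m0 /ltW] := mI 0%N n0; apply: le_trans; rewrite lee_fin ltW.
set D := itv0 a; have mD : measurable (D : set T) by exact: measurable_itv0.
have lebD : leb (D : set T) = a by exact: leb_itv0.
have I_sub k : (k < n)%N -> itv0 (m k)%:E `<=` D.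
  by move=> kn; have [_ /ltW] := mI k kn; exact: subset_itv0.
pose w1 : R -> R := fun=> 1.
have mw1 : L0 D w1 by exact: measurable_cst.
have w10 x : D x -> 0 <= w1 x by [].
rewrite (rearr_leb mD mf) -/w1.
have -> : (\sum_(k < n) (c k)%:E * \int[leb]_(t in (itv0 (m k)%:E : set T))
       rearr (wmeas w1) D f t =
    \int[leb]_(t in (D : set T)) (rearr (wmeas w1) D f t *
       (\sum_(k < n) c k * \1_(itv0 (m k)%:E) t)%:E))%E.
  rewrite [RHS](@integral_step _ _ n c (fun k => itv0 (m k)%:E) mD
    (@measurable_rearr _ _ _ _ _) (fun _ _ => rearr_ge0 _ _ _ _) c0
    (fun k _ => measurable_itv0 _)).
  apply: eq_bigr => k _; congr (_ * _)%E; congr (integral _ _ _).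
  by apply/esym/setIidPr; exact: I_sub.
have mh : measurable_fun (D : set T)
    (fun t => (\sum_(k < n) c k * \1_(itv0 (m k)%:E) t)%:E).
  apply: L0_EFin; apply: nonincreasing_L0 => x y; rewrite !inE => Dx Dy xy.
  apply: ler_sum => k _; rewrite ler_wpM2l ?c0 // !indicE.
  case: (boolP (y \in _)) => // yk; rewrite mem_set //.
  move: yk; rewrite inE => -[y0 yk]; case: Dx => x0 _; split=> //.
  by apply: le_lt_trans yk; rewrite lee_fin.
have h0 (A : nat -> set R) (t : R) :
    (0 <= (\sum_(k < n) c k * \1_(A k) t)%:E)%E.
  by rewrite lee_fin sumr_ge0 // => k _; rewrite mulr_ge0 ?c0 // indicE.
apply: (@le_layer _ T R leb D mD (rearr (wmeas w1) D f) _
  (@measurable_rearr _ _ _ _ _) mh (fun _ _ => rearr_ge0 _ _ _ _)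
  (fun x _ => h0 (fun k => itv0 (m k)%:E) x)).
move=> e K e0; pose s k : R := k.+1%:R * e.
have s0 k : 0 <= s k by rewrite mulr_ge0 // ltW.
(* Indices are shifted by one: [B 0] is the whole interval, [B j.+1] the superlevel set of layer
   [j], and [B K.+1] is empty, as [nested_sets] requires. *)
pose B k : set T := if k is l.+1 then
  (if (l < K)%N then D `&` [set x | s l < `|f x|] else set0) else D.
have mB k : measurable (B k).
  by case: k => [//|l] /=; case: ifP => // _; exact: measurable_distr_set.
have B0 x : B 0%N x -> 0 < x by case.
have BS k : B k.+1 `<=` B k.
  case: k => [|l] /=; first by case: ifP => // _ x [].
  case: ifPn => [lK|_]; last by move=> x [].
  rewrite (ltnW lK) => x [Dx] /= sx; split=> //=.
  by apply: le_lt_trans sx; rewrite ler_pM2r // ler_nat.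
have Bn : B K.+1 = set0 by rewrite /= ltnn.
have [A AP] := nested_sets mB B0 BS Bn.
have mk0 k : (k < n)%N -> 0 <= m k by move=> /mI[/ltW].
have mka k : (k < n)%N -> ((m k)%:E < leb (B 0%N : set T))%E.
  by move=> /mI[_]; rewrite lebD.
have AmP k (kn : (k < n)%N) := AP (m k) (mk0 k kn) (mka k kn).
have mA k : (k < n)%N -> measurable (A (m k) : set T) by move=> /AmP[].
have AD k : (k < n)%N -> A (m k) `<=` D by move=> /AmP[].
apply: le_trans (AC (fun k => A (m k)) _ _); last 2 first.
- by move=> k /AmP[].
- by move=> k l kn ln kl; have [_ _ _ _] := AmP k kn; apply=> //; exact: mka.
have mg : measurable_fun (D : set T)
    (fun t => (\sum_(k < n) c k * \1_(A (m k)) t)%:E).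
  apply: L0_EFin; apply: (@measurable_sum _ T R D 'I_n _
    (fun k t => c k * \1_(A (m k)) t)) => k.
  apply: L0M; first exact: measurable_cst.
  by apply: measurable_indic; exact: mA.
have mf' : measurable_fun (D : set T) (fun x => `|f x|%:E).
  exact: L0_EFin (L0_norm mf).
apply: (@le_trans _ _ (\int[leb]_(x in (D : set T)) (`|f x|%:E *
    (\sum_(k < n) c k * \1_(A (m k)) x)%:E))%E); last first.
  rewrite le_eqVlt; apply/orP; left; apply/eqP; apply: eq_integral => x _.
  have := h0 (fun k => A (m k)) x; rewrite lee_fin => hx.
  by rewrite normrM (ger0_norm hx) EFinM.
apply: le_trans (@layer_le _ T R leb D mD (fun x => `|f x|%:E) _ mf' mg
  (fun x _ => normr_ge0 (f x)) (fun x _ => h0 (fun k => A (m k)) x) e K (ltW e0)).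
apply: lee_sum => -[j jK] _ /=; apply: lee_wpmul2l; first by rewrite lee_fin ltW.
rewrite -/(s j) level_rearr //.
have -> : [set x | ((s j)%:E < `|f x|%:E)%E] = [set x | s j < `|f x|].
  by apply/funext => x /=; rewrite lte_fin.
have BjE : D `&` [set x | s j < `|f x|] = B j.+1 by rewrite /= jK.
set d := distr _ _ _ _.
have dE : d = leb (B j.+1 : set T) by rewrite /d /distr BjE wmeas1.
have d0 : (0 <= d)%E by rewrite dE.
rewrite BjE.
have mDd : measurable (D `&` itv0 d : set T).
  by apply: measurableI => //; exact: measurable_itv0.
have one E : measurable (E : set T) -> measurable_fun (E : set T) (fun=> 1%E : \bar R).
  by move=> _; exact: measurable_cst.
have := @integral_step _ (fun=> 1%E) n c (fun k => itv0 (m k)%:E) mDd (one _ mDd)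
  (fun _ _ => lee01) c0 (fun k _ => measurable_itv0 _).
under eq_integral do rewrite mul1e; move=> ->.
have := @integral_step _ (fun=> 1%E) n c (fun k => A (m k)) (mB j.+1) (one _ (mB _))
  (fun _ _ => lee01) c0 mA.
under eq_integral do rewrite mul1e; move=> ->.
apply: lee_sum => -[k kn] _ /=; apply: lee_wpmul2l; first by rewrite lee_fin c0.
rewrite -setIA !itv0I integral_itv0_cst; last first.
  by rewrite !le_min a0 d0 lee_fin mk0.
rewrite mul1e integral_cst; last by apply: measurableI; [exact: (mB j.+1)|exact: mA].
rewrite mul1e.
have [_ _ Am AB _] := AmP k kn; have [BA|AB'] := AB j.+1.
  by rewrite (setIidl BA) [leRHS](_ : _ = d) // !ge_min lexx orbT.
by rewrite (setIidr AB') [leRHS](_ : _ = (m k)%:E) // !ge_min lexx !orbT.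
Qed.

End resonance.

(** * Submajorization and fully symmetric spaces *)

Section rearrangement_extra.
Context {R : realType}.
Local Notation T := (lebesgueType R).
Implicit Types (c d : \bar R) (f g h u : R -> R).

Lemma itv0_exhaust d : (0 < d)%E -> exists2 p : nat -> R,
    {homo p : m n / (m <= n)%N >-> m <= n} &
    (forall n, itv0 d (p n)) /\ itv0 d = \bigcup_n itv0 (p n)%:E.
Proof.
move=> d0.
have nextd x : 0 <= x -> (x%:E < d)%E -> exists2 y, itv0 d y & x < y.
  case: d d0 => [r| |] // d0 x0 xd.
    rewrite lte_fin in xd; exists ((x + r) / 2); last by lra.
    by split; rewrite ?lte_fin; lra.
  by exists (x + 1); [split; rewrite ?ltry //; lra|lra].
have [x0 dx0 _] := nextd 0 (lexx 0) d0.
have [||p pmon [pd dE]] := @downset_exhaust R d (itv0 d) (@subset_refl _ _).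
- by [].
- by exists x0.
exists p => //; split=> //; apply/seteqP; split=> x; last first.
  move=> [n _ [x_gt0 xp]]; split=> //.
  by have [_] := pd n; apply: lt_trans.
move=> [x_gt0 xd]; have [y dy xy] := nextd x (ltW x_gt0) xd.
move: dy; rewrite dE => -[n _]; rewrite /= in_itv /= => /andP[_ yp].
by exists n => //; split=> //; rewrite lte_fin; exact: lt_le_trans yp.
Qed.

(** Submajorization compares integrals up to interior points only, while a superlevel set may fill
    the whole interval; exhaustion from inside bridges the gap. *)
Lemma integral_itv0_le (phi psi : R -> \bar R) d :
  measurable_fun (itv0 d : set T) phi -> measurable_fun (itv0 d : set T) psi ->
  (forall x, itv0 d x -> 0 <= phi x)%E -> (forall x, itv0 d x -> 0 <= psi x)%E ->
  (forall x, itv0 d x -> \int[leb]_(t in (itv0 x%:E : set T)) phi t <=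
                         \int[leb]_(t in (itv0 x%:E : set T)) psi t)%E ->
  (\int[leb]_(t in (itv0 d : set T)) phi t <=
   \int[leb]_(t in (itv0 d : set T)) psi t)%E.
Proof.
move=> mphi mpsi phi0 psi0 le_x.
have [d0|d0] := ltP 0%E d; last first.
  rewrite (_ : itv0 d = set0) ?integral_set0 //.
  by apply/seteqP; split=> // x [x0 /(lt_le_trans)/(_ d0)]; rewrite lte_fin ltNge ltW.
have [p pmon [pd dE]] := itv0_exhaust d0.
have ps n : itv0 (p n)%:E `<=` itv0 d by rewrite dE => x px; exists n.
have ndp : nondecreasing_seq (fun n => itv0 (p n)%:E : set T).
  by move=> m n mn; rewrite subsetEset; apply: subset_itv0; rewrite lee_fin pmon.
have mp n : measurable_fun (itv0 (p n)%:E : set T) phi.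
  by apply: measurable_funS mphi => //; exact: measurable_itv0.
have := @ge0_nondecreasing_set_cvg_integral _ T R
  (fun n => itv0 (p n)%:E : set T) phi leb ndp
  (fun n => measurable_itv0 _) mp (fun i x px => phi0 x (ps i x px)).
rewrite -dE => phicvg.
have -> : (\int[leb]_(t in (itv0 d : set T)) phi t)%E =
    limn (fun n => \int[leb]_(t in (itv0 (p n)%:E : set T)) phi t)%E.
  by apply/esym/cvg_lim.
apply: lime_le; first exact: (cvgP _ phicvg).
apply: nearW => n; apply: le_trans (le_x _ (pd n)) _.
by apply: (@ge0_subset_integral _ T R leb _ _ (measurable_itv0 _)
  (measurable_itv0 _) psi mpsi psi0).
Qed.

(** Hardy's lemma: the layers of the rearrangement of [h] are intervals starting at 0, exactly the
    sets on which submajorization compares integrals. *)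
Lemma submajorized_integral_le c f g h : L0 (itv0 c) f -> L0 (itv0 c) g ->
  L0 (itv0 c) h -> (0 <= c)%E -> submajorized (itv0 c) f g ->
  (\int[leb]_(t in (itv0 c : set T)) (rearr leb (itv0 c) h t * rearr leb (itv0 c) f t)
   <= \int[leb]_(t in (itv0 c : set T))
      (rearr leb (itv0 c) h t * rearr leb (itv0 c) g t))%E.
Proof.
move=> mf mg mh c0 fg; set D := itv0 c.
have mD : measurable (D : set T) by exact: measurable_itv0.
have mr k d : measurable_fun (itv0 d : set T) (rearr leb D k).
  exact: measurable_rearr.
have r0 k t : (0 <= rearr leb D k t)%E by exact: rearr_ge0.
apply: (@le_layer _ T R leb D mD _ _ (mr h c) (mr f c)) => // e K e0.
apply: le_trans (@layer_le _ T R leb D mD _ _ (mr h c) (mr g c)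
  (fun _ _ => r0 _ _) (fun _ _ => r0 _ _) e K (ltW e0)).
apply: lee_sum => k _; apply: lee_wpmul2l; first by rewrite lee_fin ltW.
pose w1 : R -> R := fun=> 1.
have mw1 : L0 D w1 by exact: measurable_cst.
have w10 x : D x -> 0 <= w1 x by move=> _; exact: ler01.
have s0 : 0 <= k.+1%:R * e by rewrite mulr_ge0 // ltW.
have dc : (distr (wmeas w1) D h (k.+1%:R * e) <= c)%E.
  apply: le_trans (distr_le_wmeas mD w10 mw1 _ mh) _.
  by rewrite wmeas1 // [X in (X <= _)%E]leb_itv0.
rewrite (_ : D `&` _ = itv0 (distr (wmeas w1) D h (k.+1%:R * e))); last first.
  by rewrite (rearr_leb mD mh) (level_rearr mD w10 mw1 _ mh s0) itv0I min_r.
apply: integral_itv0_le (mr f _) (mr g _) (fun _ _ => r0 _ _) (fun _ _ => r0 _ _) _.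
by move=> x [x0 xd]; apply: fg; split=> //; apply: (lt_le_trans xd).
Qed.

(** Where [h] exceeds [h t], the point lies before [t]. Equality may fail at jumps, since [h] need
    not be right continuous. *)
Lemma rearr_le_nonincreasing c h t :
  {in itv0 c &, {homo h : x y / x <= y >-> y <= x}} ->
  (forall x, itv0 c x -> 0 <= h x) -> itv0 c t ->
  (rearr leb (itv0 c) h t <= (h t)%:E)%E.
Proof.
move=> hd h0 ct; have mh : L0 (itv0 c) h by exact: nonincreasing_L0.
have mD : measurable (itv0 c : set T) by exact: measurable_itv0.
have t0 : 0 <= t by case: ct => /ltW.
pose w1 : R -> R := fun=> 1.
have mw1 : L0 (itv0 c) w1 by exact: measurable_cst.
have w10 x : itv0 c x -> 0 <= w1 x by move=> _; exact: ler01.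
rewrite (rearr_leb mD mh) (rearr_le mD w10 mw1 _ mh (h0 _ ct)).
rewrite -(distr_leb mD mh) -[leRHS](leb_itv0 (c := t%:E)) ?lee_fin //.
apply: le_measure; rewrite ?inE; first exact: measurable_distr_set.
  exact: measurable_itv0.
move=> x [cx]; rewrite /= ger0_norm ?h0 // => hx.
split; first by case: cx.
rewrite lte_fin ltNge; apply/negP => tx.
by move: hx; apply/negP; rewrite -leNgt; apply: hd; rewrite ?inE.
Qed.

Lemma ae_onW (D : set R) (P : R -> Prop) : (forall x, D x -> P x) -> ae_on D P.
Proof. by move=> DP; apply: aeW => x; exact: DP. Qed.

End rearrangement_extra.

Section fully_symmetric_spaces.
Context {R : realType}.
Local Notation T := (lebesgueType R).
Variables (b : \bar R) (E : funSpace R).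
Local Notation J := (itv0 b).
Hypotheses (E_bfs : is_banach_function_space J E)
  (E_fs : is_fully_symmetric J E) (E_supp : has_support J E).

Lemma fs_le (f g : R -> R) : L0 J f -> E g ->
  (forall x, J x -> `|f x| <= `|g x|) -> E f /\ fnorm E f <= fnorm E g.
Proof.
move=> mf Eg fg; have Ef : E f.
  by apply: (bfs_solid E_bfs mf Eg); exact: ae_onW.
by split=> //; apply: (bfs_norm_mono E_bfs) => //; exact: ae_onW.
Qed.

Lemma fs_step n (c y : nat -> R) : (forall k, (k < n)%N -> J (y k)) ->
  E (fun x => \sum_(k < n) c k * \1_(itv0 (y k)%:E) x).
Proof.
elim: n => [|n ih] yJ.
  have -> : (fun x : R => \sum_(k < 0) c k * \1_(itv0 (y k)%:E) x) = fun=> 0.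
    by apply/funext => x; rewrite big_ord0.
  exact: (bfs_zero E_bfs).
have -> : (fun x => \sum_(k < n.+1) c k * \1_(itv0 (y k)%:E) x) =
    (fun x => \sum_(k < n) c k * \1_(itv0 (y k)%:E) x) \+
    (fun x => c n * \1_(itv0 (y n)%:E) x).
  by apply/funext => x; rewrite big_ord_recr.
apply: (bfs_add E_bfs); first by apply: ih => k kn; apply: yJ; exact: ltnW.
apply: (bfs_scale E_bfs); apply: E_supp.
- exact: measurable_itv0.
- by have [_ /ltW] := yJ n (ltnSn n); exact: subset_itv0.
- have [y0 _] := yJ n (ltnSn n).
  by rewrite [X in (X < _)%E]leb_itv0 ?ltry // lee_fin ltW.
Qed.

Lemma fs_submajorized (h u : R -> R) : E u ->
  {in J &, {homo h : x y / x <= y >-> y <= x}} ->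
  (forall x, J x -> 0 <= h x) ->
  (forall x, J x -> \int[leb]_(t in (itv0 x%:E : set T)) (h t)%:E <=
                    \int[leb]_(t in (itv0 x%:E : set T)) rearr leb J u t)%E ->
  E h /\ fnorm E h <= fnorm E u.
Proof.
move=> Eu hd h0 hu; have mh : L0 J h by exact: nonincreasing_L0.
apply: (fs_sub E_fs mh Eu) => x Jx; apply: le_trans (hu x Jx).
have xJ : itv0 x%:E `<=` J by exact: sub_itv0.
have mhx : L0 (itv0 x%:E) h by apply: L0S xJ mh; exact: measurable_itv0.
apply: (@ge0_le_integral _ T R leb _ (measurable_itv0 _) _ _
  (fun _ _ => rearr_ge0 _ _ _ _) (@measurable_rearr _ _ _ _ _) (L0_EFin mhx)).
by move=> t /xJ Jt; exact: rearr_le_nonincreasing.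
Qed.

Lemma integral_le_rearr (x : R) (u : R -> R) : L0 J u -> J x ->
  (\int[leb]_(t in (itv0 x%:E : set T)) `|u t|%:E <=
   \int[leb]_(t in (itv0 x%:E : set T)) rearr leb J u t)%E.
Proof.
move=> mu Jx; have mJ : measurable (J : set T) by exact: measurable_itv0.
have x0 : 0 <= x by case: Jx => /ltW.
have := @hardy_littlewood_set R J (fun=> 1) mJ (fun _ _ => ler01)
  (@measurable_cst _ _ _ _ _ _) (itv0 x%:E) u (measurable_itv0 _) (sub_itv0 Jx) mu.
rewrite wmeas1; last exact: measurable_itv0.
rewrite [in X in (_ <= X)%E -> _]leb_itv0 ?lee_fin // -rearr_leb //.
by under eq_integral do rewrite mulr1.
Qed.

End fully_symmetric_spaces.

Lemma ae_on_imply2 (R : realType) (D : set R) (P Q S : R -> Prop) :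
  ae_on D P -> ae_on D Q -> (forall x, D x -> P x -> Q x -> S x) -> ae_on D S.
Proof.
move=> DP DQ PQS.
apply: (@filterS2 _ _ (@ae_filter_ringOfSetsType _ (lebesgueType R) R leb)
  _ _ _ _ DP DQ) => x Px Qx Dx.
by apply: PQS => //; [exact: Px|exact: Qx].
Qed.

Lemma bfs_norm0 (R : realType) (D : set R) (E : funSpace R) :
  is_banach_function_space D E -> fnorm E (fun=> 0) = 0.
Proof.
move=> E_bfs; have -> : (fun=> 0 : R) = (fun x : R => 0 * (fun=> 0 : R) x).
  by apply/funext => x; rewrite mul0r.
by rewrite (bfs_normZ E_bfs 0 (bfs_zero E_bfs)) normr0 mul0r.
Qed.

Lemma kothe_gauge_ge0 (R : realType) (D : set R) (E : funSpace R) f u :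
  E u -> fnorm E u <= 1 -> (0 <= kothe_gauge D E f)%E.
Proof.
move=> Eu u1; apply: ereal_sup_ge.
exists (\int[leb]_(x in (D : set (lebesgueType R))) `|f x * u x|%:E)%E.
  by exists u.
by apply: integral_ge0 => x _; rewrite lee_fin.
Qed.

(** * The upper bound for the pairing *)

Section weighted_duality.
Context {R : realType}.
Local Notation T := (lebesgueType R).
Variables (a : \bar R) (w : R -> R) (E : funSpace R).
Local Notation I := (itv0 a).
Local Notation b := (wmeas w I).
Local Notation J := (itv0 b).
Hypotheses (a_gt0 : (0 < a)%E) (w_gt0 : forall x, I x -> 0 < w x)
  (w_decr : {in I &, {homo w : x y / x <= y >-> y <= x}}).

Let mI : measurable (I : set T). Proof. exact: measurable_itv0. Qed.
Let mJ : measurable (J : set T). Proof. exact: measurable_itv0. Qed.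
Let mw : L0 I w. Proof. exact: nonincreasing_L0. Qed.
Let w0 x : I x -> 0 <= w x. Proof. by move=> /w_gt0/ltW. Qed.

Lemma rearr_div_finP g x : I x -> rearr_div I w g x \is a fin_num ->
  rearr leb I g x = ((fine \o rearr_div I w g) x * w x)%:E.
Proof.
move=> Ix; rewrite /rearr_div /=; have := rearr_ge0 I leb g x.
have wx := w_gt0 Ix; case: (rearr leb I g x) => [r| |] //=.
  by move=> _ _; rewrite divfK // gt_eqF.
by rewrite gt0_mulye // lte_fin invr_gt0.
Qed.

Lemma measurable_rearr_div g : measurable_fun (I : set T) (rearr_div I w g).
Proof.
apply: emeasurable_funM; first exact: measurable_rearr.
have mN : L0 I (fun x => - (w x)^-1).
  apply: nonincreasing_L0 => x y Ix Iy xy; rewrite lerN2.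
  have wx := w_gt0 (set_mem Ix); have wy := w_gt0 (set_mem Iy).
  by rewrite lef_pV2 ?posrE // w_decr.
have -> : (fun x => (w x)^-1%:E) = (fun x => (-1 * - (w x)^-1)%:E).
  by apply/funext => x; rewrite mulN1r opprK.
exact: L0_EFin (L0M (@measurable_cst _ _ _ _ _ _) mN).
Qed.

(** After Hardy-Littlewood for [m] and Hardy's lemma, the integrand is the product of the
    rearrangements of [g] and [u], rewritten as [psi * v * w]. As [psi] need not be monotone,
    Hardy-Littlewood for [w dm] is what carries the integral from [I] to [J]. *)
Lemma integral_le_kothe_gauge f g u :
  L0 I f -> M_space I J w (kothe_dual J E) g -> submajorized I f g ->
  Lambda_space I J w E u -> fnorm (Lambda_space I J w E) u <= 1 ->
  (\int[leb]_(x in (I : set T)) `|f x * u x|%:E <=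
   kothe_gauge J E (fine \o rearr (wmeas w) I (fine \o rearr_div I w g)))%E.
Proof.
move=> mf [mg [gfin [mpsi [psifin [mchi _]]]]] fg [mu [ufin [mv [vfin Ev]]]] u1.
set psi := fine \o rearr_div I w g; set chi := fine \o _.
set v := fine \o rearr leb I u in mv vfin Ev; set v' := fine \o _ in Ev.
have w10 x : I x -> 0 <= (fun=> 1 : R) x by move=> _; exact: ler01.
have mw1 : L0 I (fun=> 1) by exact: measurable_cst.
have mr k d : measurable_fun (itv0 d : set T) (rearr leb I k).
  exact: measurable_rearr.
have mrw k d : measurable_fun (itv0 d : set T) (rearr (wmeas w) I k).
  exact: measurable_rearr.
have r0 nu k t : (0 <= rearr nu I k t)%E by exact: rearr_ge0.
have a0 : (0 <= a)%E by exact: ltW.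
apply: (@le_trans _ _ (\int[leb]_(x in (I : set T)) (`|u x| * `|f x| * 1)%:E)%E).
  rewrite le_eqVlt; apply/orP; left; apply/eqP; apply: eq_integral => x _.
  by rewrite normrM mulr1 mulrC.
apply: le_trans (hardy_littlewood mI w10 mw1 mu mf) _.
rewrite (wmeas1 mI) [X in itv0 X]leb_itv0 // -(rearr_leb mI mu) -(rearr_leb mI mf).
apply: le_trans (submajorized_integral_le mf mg mu a0 fg) _.
apply: (@le_trans _ _ (\int[leb]_(x in (I : set T)) (`|psi x| * `|v x| * w x)%:E)%E).
  rewrite le_eqVlt; apply/orP; left; apply/eqP.
  (* [fine] sends infinite values to 0, so the integrands are identified only where [gfin] and
     [ufin] provide finiteness. *)
  apply: (@ge0_ae_eq_integral _ T R leb I _ _ mI).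
  - exact: emeasurable_funM.
  - exact: L0_EFin (L0M (L0M (L0_norm mpsi) (L0_norm mv)) mw).
  - by move=> x _; rewrite mule_ge0.
  - by move=> x Ix; rewrite lee_fin !mulr_ge0 ?w0.
  apply: (ae_on_imply2 gfin ufin) => x Ix gx ux.
  rewrite (rearr_div_finP Ix gx) -(fineK ux) -EFinM.
  rewrite (ger0_norm (x := psi x)); last first.
    apply: fine_ge0; rewrite /rearr_div mule_ge0 // lee_fin invr_ge0 w0 //.
  rewrite (ger0_norm (x := v x)); last by apply: fine_ge0.
  by rewrite /v /psi /=; congr EFin; ring.
apply: le_trans (hardy_littlewood mI w0 mw mpsi mv) _.
apply: (@le_trans _ _ (\int[leb]_(x in (J : set T)) `|chi x * v' x|%:E)%E); last first.
  by apply: ereal_sup_ubound; exists v'.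
rewrite le_eqVlt; apply/orP; left; apply/eqP.
have mv' : L0 J v' by apply: measurableT_comp.
apply: (@ge0_ae_eq_integral _ T R leb J _ _ mJ).
- exact: emeasurable_funM.
- exact: L0_EFin (L0_norm (L0M mchi mv')).
- by move=> x _; rewrite mule_ge0.
- by [].
apply: (ae_on_imply2 psifin vfin) => x Jx px vx.
rewrite -(fineK px) -(fineK vx) -EFinM ger0_norm //.
by rewrite mulr_ge0 // fine_ge0.
Qed.

End weighted_duality.

(** * The level function yields a majorant in [M] *)

Section level_majorant.
Context {R : realType}.
Local Notation T := (lebesgueType R).
Variables (a : \bar R) (w : R -> R) (E : funSpace R).
Local Notation I := (itv0 a).
Local Notation b := (wmeas w I).
Local Notation J := (itv0 b).
Hypotheses (a_gt0 : (0 < a)%E) (w_gt0 : forall x, I x -> 0 < w x)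
  (w_decr : {in I &, {homo w : x y / x <= y >-> y <= x}})
  (W_fin : forall t, I t ->
    (\int[leb]_(x in (itv0 t%:E : set T)) (w x)%:E < +oo)%E)
  (E_bfs : is_banach_function_space J E)
  (E_fs : is_fully_symmetric J E) (E_supp : has_support J E).

Let mI : measurable (I : set T). Proof. exact: measurable_itv0. Qed.
Let mJ : measurable (J : set T). Proof. exact: measurable_itv0. Qed.
Let mw : L0 I w. Proof. exact: nonincreasing_L0. Qed.
Let w0 x : I x -> 0 <= w x. Proof. by move=> /w_gt0/ltW. Qed.
Let mw1 (D : set T) : L0 D (fun=> 1). Proof. exact: measurable_cst. Qed.
Let w10 (D : set T) x : D x -> 0 <= (fun=> 1 : R) x. Proof. by move=> _; exact: ler01. Qed.

Local Notation wE := (fun x => (w x)%:E).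
Local Notation W := (primitive wE).

Let wE0 x : I x -> (0 <= wE x)%E. Proof. by move=> Ix; rewrite lee_fin w0. Qed.
Let wEd : {in I &, {homo wE : x y / x <= y >-> (y <= x)%E}}.
Proof. by move=> x y Ix Iy xy; rewrite lee_fin w_decr. Qed.

Let WK t : I t -> wmeas w (itv0 t%:E) = (W t)%:E.
Proof. by move=> [_ ta]; exact: (primitiveK wE0 W_fin). Qed.

Let W_homo s t : (t%:E < a)%E -> s <= t -> W s <= W t.
Proof. exact: (primitive_homo wE0 wEd W_fin). Qed.

Let W_incr s t : I t -> 0 <= s -> s < t -> W s < W t.
Proof.
move=> It s0 st; rewrite -subr_gt0.
apply: lt_le_trans (primitive_lbound wE0 wEd W_fin It s0 (ltW st)).
by rewrite mulr_gt0 ?subr_gt0 //= w_gt0.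
Qed.

Let W0 : W 0 = 0. Proof. exact: primitive_nonpos. Qed.

Let W_gt0 t : I t -> 0 < W t.
Proof. by move=> It; rewrite -W0; apply: W_incr => //; case: It. Qed.

Let next x : I x -> exists2 y, I y & x < y.
Proof.
move=> [x0]; case: a => [r| |] //.
  rewrite lte_fin => xr; exists ((x + r) / 2); last by lra.
  by split; rewrite ?lte_fin; lra.
by move=> _; exists (x + 1); [split; rewrite ?ltry //; lra|lra].
Qed.

Let JW t : I t -> J (W t).
Proof.
move=> It; split; first exact: W_gt0.
have [t' It' tt'] := next It.
apply: (@lt_le_trans _ _ (W t')%:E).
  by rewrite lte_fin W_incr //; case: It => /ltW.
rewrite -WK //; apply: (wmeas_le mI w0 mw) => //; first exact: measurable_itv0.
exact: sub_itv0.
Qed.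

Let measurable_fine_rearr (mu : set R -> \bar R) D f c : L0 (itv0 c) (fine \o rearr mu D f).
Proof.
have mr : measurable_fun (itv0 c : set T) (rearr mu D f) by exact: measurable_rearr.
by apply: measurableT_comp.
Qed.

Let integral_step_itv0 n (c y : nat -> R) z :
  (forall k, (k < n)%N -> 0 <= c k) -> (forall k, (k < n)%N -> 0 <= y k) ->
  0 <= z ->
  (\int[leb]_(t in (itv0 z%:E : set T))
      (\sum_(k < n) c k * \1_(itv0 (y k)%:E) t)%:E =
   (\sum_(k < n) c k * Num.min z (y k))%:E)%E.
Proof.
move=> c0 y0 z0.
have := @integral_step R (itv0 z%:E) (fun=> 1%E) n c (fun k => itv0 (y k)%:E)
  (measurable_itv0 _) (@measurable_cst _ _ _ _ _ _)
  (fun _ _ => lee01) c0 (fun k _ => measurable_itv0 _).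
under eq_integral do rewrite mul1e.
move=> ->; rewrite -sumEFin; apply: eq_bigr => k _.
rewrite itv0I integral_itv0_cst ?le_min ?lee_fin ?z0 ?y0 // mul1e EFinM.
by rewrite EFin_min.
Qed.

Let step_anti n (c y : nat -> R) x z : (forall k, (k < n)%N -> 0 <= c k) ->
  0 < x -> x <= z ->
  \sum_(k < n) c k * \1_(itv0 (y k)%:E) z <= \sum_(k < n) c k * \1_(itv0 (y k)%:E) x.
Proof.
move=> c0 x0 xz; apply: ler_sum => k _; rewrite ler_wpM2l ?c0 // !indicE.
case: (boolP (z \in _)) => // zk; rewrite mem_set //.
move: zk; rewrite inE => -[_ zk]; split=> //.
by apply: le_lt_trans zk; rewrite lee_fin.
Qed.

Let step_ge0 n (c : nat -> R) (A : nat -> set R) x :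
  (forall k, (k < n)%N -> 0 <= c k) -> 0 <= \sum_(k < n) c k * \1_(A k) x.
Proof. by move=> c0; apply: sumr_ge0 => k _; rewrite mulr_ge0 ?c0 // indicE. Qed.

(** Rearranging replaces each [A k] by [(0, m k)], and rearranging again for [w dm] replaces that by
    [(0, W (m k))]. Only the upper estimate is needed, and it holds pointwise on [J]. *)
Lemma step_Lambda n (c m : nat -> R) (A : nat -> set R) :
  (forall k, (k < n)%N -> 0 <= c k) -> (forall k, (k < n)%N -> I (m k)) ->
  (forall k, (k < n)%N -> [/\ measurable (A k : set T), A k `<=` I &
       leb (A k : set T) = (m k)%:E]) ->
  (forall k l, (k < n)%N -> (l < n)%N -> m k <= m l -> A k `<=` A l) ->
  Lambda_space I J w E (fun x => \sum_(k < n) c k * \1_(A k) x) /\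
  fnorm (Lambda_space I J w E) (fun x => \sum_(k < n) c k * \1_(A k) x) <=
  fnorm E (fun t => \sum_(k < n) c k * \1_(itv0 (W (m k))%:E) t).
Proof.
move=> c0 mm AP Amon; set g := fun x => _; set H := fun t => _.
have mA k : (k < n)%N -> measurable (A k : set T) by move=> /AP[].
have AI k : (k < n)%N -> A k `<=` I by move=> /AP[].
have lA k : (k < n)%N -> leb (A k : set T) = (m k)%:E by move=> /AP[].
have mg : L0 I g.
  apply: (@measurable_sum _ T R I 'I_n _ (fun k t => c k * \1_(A k) t)) => k.
  apply: L0M; first exact: measurable_cst.
  by apply: measurable_indic; exact: mA.
have g0 x : 0 <= g x by exact: (@step_ge0 n c A).
have H0 x : 0 <= H x by exact: (@step_ge0 n c (fun k => itv0 (W (m k))%:E)).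
pose M := \sum_(k < n) c k.
have M0 : 0 <= M by apply: sumr_ge0 => k _; exact: c0.
have gM x : g x <= M.
  by apply: ler_sum => k _; rewrite ler_piMr ?c0 // indicE lern1 leq_b1.
have gs_fin t : 0 <= t -> rearr leb I g t \is a fin_num.
  move=> t0; rewrite (ge0_fin_numE (rearr_ge0 _ _ _ _)).
  apply: (@le_lt_trans _ _ M%:E _ _ _ (ltry _)).
  rewrite (rearr_leb mI mg) (rearr_le mI (@w10 I) (@mw1 I) _ mg M0).
  rewrite /distr (_ : _ `&` _ = set0) ?wmeas1 ?measure0 ?lee_fin //.
  apply/seteqP; split=> // x [_] /=; rewrite ger0_norm ?g0 //.
  by rewrite ltNge gM.
pose v := fine \o rearr leb I g.
have v0 x : 0 <= v x by apply/fine_ge0/rearr_ge0.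
have mv : L0 I v by exact: measurable_fine_rearr.
have vH t : J t -> (rearr (wmeas w) I v t <= (H t)%:E)%E.
  move=> Jt; rewrite (rearr_le mI w0 mw _ mv (H0 t)).
  have t0 : 0 <= t by case: Jt => /ltW.
  have -> : distr (wmeas w) I v (H t) =
      wmeas w (itv0 (distr (wmeas (fun=> 1)) I g (H t))).
    rewrite /distr; congr (wmeas w _).
    transitivity (I `&` [set x : R | ((H t)%:E < rearr (wmeas (fun=> 1%R)) I g x)%E]).
      have vE x : I x -> (v x)%:E = rearr (wmeas (fun=> 1)) I g x.
        by move=> [/ltW x0 _]; rewrite -(rearr_leb mI mg) /v /= fineK // gs_fin.
      by apply/seteqP; split=> x [Ix] /= Hx; split=> //=; move: Hx;
        rewrite -vE // lte_fin ger0_norm.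
    rewrite (level_rearr mI (@w10 I) (@mw1 I) _ mg (H0 t)) itv0I min_r //.
    apply: le_trans (distr_le_wmeas mI (@w10 I) (@mw1 I) _ mg) _.
    by rewrite wmeas1 // [X in (X <= _)%E]leb_itv0 // ltW.
  have gH x : H t < g x -> exists2 k : 'I_n, W (m k) <= t & A k x.
    move=> Hg; apply: contrapT => nk; move: Hg; apply/negP; rewrite -leNgt.
    apply: ler_sum => k _; rewrite ler_wpM2l ?c0 // !indicE.
    case: (boolP (x \in A k)) => // /set_mem Akx; rewrite mem_set //.
    split; first by case: Jt.
    by rewrite lte_fin ltNge; apply/negP => Wt; apply: nk; exists k.
  have [[k0 k0t]|nk] := pselect (exists k : 'I_n, W (m k) <= t); last first.
    rewrite /distr (_ : I `&` _ = set0); last first.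
      apply/seteqP; split=> // x [_] /=; rewrite ger0_norm ?g0 // => /gH[k kt _].
      by apply: nk; exists k.
    rewrite wmeas1 // measure0 (_ : itv0 _ = set0).
      by rewrite /wmeas integral_set0 lee_fin.
    by apply/seteqP; split=> // x [x0]; rewrite lte_fin ltNge ltW.
  (* Points where [g] exceeds [H t] lie in some [A k] with [W (m k) <= t]; by nesting the largest of
     these sets, [A q], contains them all. *)
  pose q := [arg max_(k > k0 | W (m k) <= t) m k]%O.
  have [qt qmax] : W (m q) <= t /\ forall k : 'I_n, W (m k) <= t -> m k <= m q.
    by rewrite /q; case: arg_maxP.
  apply: (@le_trans _ _ (W (m q))%:E); last by rewrite lee_fin.
  rewrite -WK; last exact: mm.
  apply: (wmeas_le mI w0 mw); [exact: measurable_itv0|exact: measurable_itv0| |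
    exact/sub_itv0/mm].
  apply: subset_itv0; rewrite /distr wmeas1; last exact: measurable_distr_set.
  rewrite -lA //; apply: le_measure; rewrite ?inE.
  - exact: measurable_distr_set.
  - exact: mA.
  - move=> x [Ix] /=; rewrite ger0_norm ?g0 // => /gH[k kt].
    by apply: Amon => //; exact: qmax.
have v'_fin t : J t -> rearr (wmeas w) I v t \is a fin_num.
  move=> Jt; rewrite ge0_fin_numE; last exact: rearr_ge0.
  by apply: le_lt_trans (vH t Jt) _; exact: ltry.
have EH : E H.
  by apply: (@fs_step _ _ _ E_bfs E_supp n c (fun k => W (m k))) => k kn; exact/JW/mm.
have [|Ev' v'H] := @fs_le _ _ _ E_bfs (fine \o rearr (wmeas w) I v) H
    (@measurable_fine_rearr _ _ _ _) EH.
  move=> t Jt; rewrite (ger0_norm (H0 t)) ger0_norm; last exact/fine_ge0/rearr_ge0.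
  by rewrite -lee_fin /= fineK ?v'_fin // vH.
split=> //; split=> //; split.
  by apply: ae_onW => x [/ltW x0 _]; exact: gs_fin.
by split=> //; split=> //; exact: ae_onW.
Qed.

(** * Consequences of a bound [N] on the pairings of [f] *)

Variables (f : R -> R) (N : R).
Hypotheses (mf : L0 I f)
  (fN : forall u, Lambda_space I J w E u -> fnorm (Lambda_space I J w E) u <= 1 ->
    (\int[leb]_(x in (I : set T)) `|f x * u x|%:E <= N%:E)%E).

(** The form in which [fN] is mostly used: the sets in [I] are gone, and only step functions on [J]
    and integrals of the rearrangement of [f] remain. *)
Let res n (c m : nat -> R) :
  (forall k, (k < n)%N -> 0 <= c k) -> (forall k, (k < n)%N -> I (m k)) ->
  fnorm E (fun t => \sum_(k < n) c k * \1_(itv0 (W (m k))%:E) t) <= 1 ->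
  (\sum_(k < n) (c k)%:E *
    \int[leb]_(t in (itv0 (m k)%:E : set T)) rearr leb I f t <= N%:E)%E.
Proof.
move=> c0 mm H1; apply: resonance => // A AP Amon.
have [gL gH] := step_Lambda c0 mm AP Amon.
by apply: fN => //; exact: le_trans gH H1.
Qed.

Local Notation fs := (rearr leb I f).
Local Notation F := (primitive fs).

Let step_norm_le n (c y : nat -> R) (u : R -> R) : E u ->
  (forall k, (k < n)%N -> 0 <= c k) -> (forall k, (k < n)%N -> J (y k)) ->
  (forall x, J x -> (\sum_(k < n) c k * Num.min x (y k))%:E <=
     \int[leb]_(t in (itv0 x%:E : set T)) rearr leb J u t)%E ->
  fnorm E (fun t => \sum_(k < n) c k * \1_(itv0 (y k)%:E) t) <= fnorm E u.
Proof.
move=> Eu c0 yJ le_u; apply: (fs_submajorized E_fs Eu _ _ _).2.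
- by move=> s t; rewrite !inE => -[s0 _] _ st; exact: step_anti.
- by move=> x _; exact: (@step_ge0 n c (fun k => itv0 (y k)%:E)).
- move=> x Jx; rewrite integral_step_itv0; [exact: le_u|exact: c0| |].
    by move=> k kn; case: (yJ k kn) => /ltW.
  by case: Jx => /ltW.
Qed.

(** Written as a sum with one term so that the lemmas on step functions apply verbatim. *)
Let ind (c y : R) : R -> R := fun t => \sum_(k < 1) c * \1_(itv0 y%:E) t.

Let E_ind c y : J y -> E (ind c y).
Proof.
by move=> Jy; apply: (@fs_step _ _ _ E_bfs E_supp 1 (fun=> c) (fun=> y)).
Qed.

Let norm_ind c y : J y -> 0 <= c -> fnorm E (ind c y) = c * fnorm E (ind 1 y).
Proof.
move=> Jy c0; rewrite -[in RHS](ger0_norm c0) -(bfs_normZ E_bfs); last exact: E_ind.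
by congr (fnorm E _); apply/funext => t; rewrite /ind !big_ord1 mul1r.
Qed.

Let res_ind c t : I t -> 0 <= c -> c * fnorm E (ind 1 (W t)) <= 1 ->
  (c%:E * \int[leb]_(x in (itv0 t%:E : set T)) fs x <= N%:E)%E.
Proof.
move=> It c0 c1; have := @res 1 (fun=> c) (fun=> t) (fun _ _ => c0) (fun _ _ => It).
rewrite big_ord1; apply.
have := norm_ind (JW It) c0; rewrite /ind => ->; exact: c1.
Qed.

Let norm1_ge0 y : J y -> 0 <= fnorm E (ind 1 y).
Proof. by move=> Jy; apply: (bfs_norm_ge0 E_bfs); exact: E_ind. Qed.

Let fs0 x : I x -> (0 <= fs x)%E. Proof. by move=> _; exact: rearr_ge0. Qed.
Let fsd : {in I &, {homo fs : x y / x <= y >-> (y <= x)%E}}.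
Proof. by move=> x y _ _; exact: rearr_anti. Qed.

Let F_fin t : I t -> (\int[leb]_(x in (itv0 t%:E : set T)) fs x < +oo)%E.
Proof.
move=> It; have n0 := norm1_ge0 (JW It).
(* Scaling by [1/(r + 1)] makes the norm at most 1 without a proof that [r] is positive. *)
set r := fnorm E _ in n0; have r1 : 0 < r + 1 by lra.
have := @res_ind (r + 1)^-1 t It; rewrite -/r invr_ge0 ltW // => /(_ isT).
rewrite mulrC ler_pdivrMr // mul1r lerDl => /(_ ler01) h.
rewrite ltey; apply/eqP => Fy; move: h; rewrite Fy gt0_muley ?lte_fin ?invr_gt0 //.
Qed.

Let FK t : (t%:E < a)%E -> (\int[leb]_(x in (itv0 t%:E : set T)) fs x = (F t)%:E)%E.
Proof. exact: (primitiveK fs0 F_fin). Qed.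

Let F0 : F 0 = 0. Proof. exact: primitive_nonpos. Qed.

Let F_homo s t : (t%:E < a)%E -> s <= t -> F s <= F t.
Proof. exact: (primitive_homo fs0 fsd F_fin). Qed.

Let F_cont t : (t%:E < a)%E -> {for t, continuous F}.
Proof. exact: (primitive_continuous fs0 fsd F_fin). Qed.

Let W_cont t : (t%:E < a)%E -> {for t, continuous W}.
Proof. exact: (primitive_continuous wE0 wEd W_fin). Qed.

(** Quasi-concavity of the fundamental function: spreading the mass of the indicator of [(0, W x)]
    evenly over [(0, W y)] gives a submajorized function, with norm at most [K]. Testing with it,
    scaled by [1/(K + 1)], bounds [F y] by a multiple of [W y]. *)
Let FW_bounded x : I x -> exists C, forall y, I y -> x < y -> F y <= C * W y.
Proof.
move=> Ix; set K := fnorm E (ind 1 (W x)).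
have K0 : 0 <= K by apply: norm1_ge0; exact: JW.
have Wx0 := W_gt0 Ix.
exists (N * (K + 1) / W x) => y Iy xy.
have Wy0 := W_gt0 Iy; have Wxy : W x < W y by apply: W_incr => //; case: Ix => /ltW.
have nle : W x / W y * fnorm E (ind 1 (W y)) <= K.
  have c0 : 0 <= W x / W y by rewrite divr_ge0 // ltW.
  rewrite -norm_ind //; last exact: JW.
  apply: (@step_norm_le 1 (fun=> W x / W y) (fun=> W y)) => //.
  - by apply: E_ind; exact: JW.
  - by move=> _ _; exact: JW.
  move=> z Jz; have z0 : 0 <= z by case: Jz => /ltW.
  have EJ : L0 J (ind 1 (W x)) by apply: (bfs_sub E_bfs); apply: E_ind; exact: JW.
  apply: le_trans (integral_le_rearr EJ Jz).
  have -> : (\int[leb]_(t in (itv0 z%:E : set T)) `|ind 1 (W x) t|%:E =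
      \int[leb]_(t in (itv0 z%:E : set T))
        (\sum_(k < 1) 1 * \1_(itv0 (W x)%:E) t)%:E)%E.
    apply: eq_integral => t _; rewrite ger0_norm //.
    exact: (@step_ge0 1 (fun=> 1) (fun=> itv0 (W x)%:E)).
  rewrite (@integral_step_itv0 1 (fun=> 1) (fun=> W x)) //; last first.
    by move=> _ _; exact: ltW.
  rewrite lee_fin !big_ord1 mul1r mulrAC ler_pdivrMr //.
  have [zx|xz] := leP z (W x).
    rewrite min_l; last by apply: le_trans zx _; exact: ltW.
    by nra.
  have : Num.min z (W y) <= W y by rewrite ge_min lexx orbT.
  nra.
have r1 : 0 < K + 1 by lra.
have c0 : 0 < (K + 1)^-1 * (W x / W y) by rewrite mulr_gt0 ?invr_gt0 ?divr_gt0.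
have h := @res_ind _ y Iy (ltW c0).
have {}h : (K + 1)^-1 * (W x / W y) * F y <= N.
  rewrite -lee_fin EFinM -FK; last by case: Iy.
  apply: h; rewrite -mulrA mulrC ler_pdivrMr // mul1r.
  by apply: le_trans nle _; lra.
have -> : N * (K + 1) / W x * W y = N / ((K + 1)^-1 * (W x / W y)).
  by field; rewrite !gt_eqF.
by rewrite ler_pdivlMr // mulrC.
Qed.

Local Notation L := (level_fun a F W).

Let L_ge0 x : I x -> 0 <= L x.
Proof. exact: (level_fun_ge0 F0 W0 F_homo W_incr FW_bounded). Qed.

Let L_anti : {in I &, {homo L : x y / x <= y >-> y <= x}}.
Proof. exact: (level_fun_anti F0 W0 F_homo W_incr FW_bounded). Qed.

Let mL : L0 I L. Proof. exact: nonincreasing_L0. Qed.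

Let F_le x : I x ->
  ((F x)%:E <= \int[leb]_(t in (itv0 x%:E : set T)) (L t * w t)%:E)%E.
Proof.
move=> Ix; have [x0 xa] := Ix; have Wx0 := W_gt0 Ix.
apply/lee_addgt0Pr => eta eta0.
have eta2 : 0 < eta / 2 by lra.
have [z0 /andP[z00 z0x] Fz0] := primitive_small fs0 fsd F_fin Ix eta2.
have Iz0 : I z0 by exact: itv0_le Ix _ _.
have Wz0 := W_gt0 Iz0.
(* The error [eta] is split into [eta / 4] for each of the two terms dropped below and [eta / 2] for
   the tail. *)
pose e := eta / (4 * W x).
have e0 : 0 < e by rewrite divr_gt0 ?mulr_gt0.
have Fx0 : 0 <= F x by rewrite -F0; apply: F_homo => //; exact: ltW.
(* [K] makes the subtracted part of the tail at least [F x] once the last point is beyond [z0];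
   before [z0], [F] itself is below [eta / 2]. *)
pose K := Num.bound (F x / (W z0 * e)).
have FK' : F x <= K.+2%:R * e * W z0.
  have WE0 : 0 < W z0 * e by rewrite mulr_gt0.
  rewrite -mulrA [e * _]mulrC -ler_pdivrMr //.
  apply: le_trans (_ : K%:R <= _); last by rewrite ler_nat -addn2 leq_addr.
  by apply/ltW/archi_boundP; rewrite divr_ge0 // ltW.
have [m [mx mL' Fle]] :=
  level_fun_steps F0 W0 W_incr F_cont W_cont FW_bounded K.+2 Ix e0.
have mm k : ((m k)%:E < a)%E by apply: le_lt_trans xa; rewrite lee_fin; case/andP: (mx k).
have Wm k : W (m k) <= W x by apply: W_homo => //; case/andP: (mx k).
have tail : F (m K.+2) - K.+2%:R * e * W (m K.+2) <= eta / 2.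
  have Wm0 : 0 <= W (m K.+2).
    by rewrite -W0; apply: W_homo => //; case/andP: (mx K.+2).
  have se0 : 0 <= K.+2%:R * e by rewrite mulr_ge0 // ltW.
  have [mz|zm] := leP (m K.+2) z0.
    have : F (m K.+2) <= F z0 by apply: F_homo => //; case: Iz0.
    have : 0 <= K.+2%:R * e * W (m K.+2) by rewrite mulr_ge0.
    lra.
  have h1 : F (m K.+2) <= F x by apply: F_homo => //; case/andP: (mx K.+2).
  have h2 : K.+2%:R * e * W z0 <= K.+2%:R * e * W (m K.+2).
    by rewrite ler_wpM2l //; apply: W_homo => //; exact: ltW.
  lra.
have eW : e * W x = eta / 4 by rewrite /e; field; lra.
have head k : e * W (m k) <= eta / 4 by rewrite -eW ler_pM2l.
(* The shift by two reconciles the thresholds: layer [k] needs [L] strictly above [(k+1) e], and on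
   [(0, m k.+2)] it is at least [(k+2) e]. *)
have sumE : F x - eta <= \sum_(k < K) e * W (m k.+2).
  move: Fle; rewrite 2!big_ord_recl /= /bump /=.
  have := head 0%N; have := head 1%N; move: tail => /=; lra.
rewrite -leeBlDr // -EFinB; apply: le_trans (_ : (\sum_(k < K) e * W (m k.+2))%:E <= _)%E.
  by rewrite lee_fin.
have xI : itv0 x%:E `<=` I by exact: sub_itv0.
have mx0 : measurable (itv0 x%:E : set T) by exact: measurable_itv0.
have mLx : measurable_fun (itv0 x%:E : set T) (fun t => (L t)%:E).
  exact: L0_EFin (L0S mI xI mL).
have mwx : measurable_fun (itv0 x%:E : set T) (fun t => (w t)%:E).
  exact: L0_EFin (L0S mI xI mw).
under eq_integral do rewrite EFinM.
apply: le_trans (@layer_le _ T R leb _ mx0 _ _ mLx mwx _ _ e K (ltW e0)).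
- rewrite -sumEFin; apply: lee_sum => k _; rewrite EFinM.
  apply: lee_wpmul2l; first by rewrite lee_fin ltW.
  rewrite -(primitiveK wE0 W_fin) //.
  apply: (@ge0_subset_integral _ T R leb _ _ (measurable_itv0 _)).
  + exact: (@emeasurable_fun_o_infty _ T R (itv0 x%:E) (fun t => (L t)%:E)).
  + by apply: measurable_funS mwx => //; exact: subIsetl.
  + by move=> t [/xI It _]; exact: wE0.
  + move=> t [t0 tm]; have tx : itv0 x%:E t.
      split=> //; apply: lt_le_trans tm _; rewrite lee_fin.
      by case/andP: (mx k.+2).
    split=> //=; rewrite lte_fin; apply: lt_le_trans (mL' k.+2 t _); last first.
      by rewrite t0 -lte_fin.
    by rewrite ltr_pM2r // ltr_nat.
- by move=> t /xI It; rewrite lee_fin L_ge0.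
- by move=> t /xI It; exact: wE0.
Qed.

(** The endpoint carries no mass: enlarging the interval to [(0, q)] with [q - p] at most [e / w p]
    adds at most [e]. *)
Let wmeas_oc p : I p -> (wmeas w `]0%R, p]%classic <= (W p)%:E)%E.
Proof.
move=> Ip; have [p0 _] := Ip; apply/lee_addgt0Pr => e e0.
have [y Iy py] := next Ip; have wp := w_gt0 Ip.
pose q := Num.min y (p + e / w p).
have pq : p < q by rewrite lt_min py ltrDl divr_gt0.
have Iq : I q by apply: itv0_le Iy _ _; rewrite ?(lt_trans p0) // ge_min lexx.
apply: (@le_trans _ _ (W q)%:E).
  rewrite -WK //; apply: (wmeas_le mI w0 mw).
  - exact: measurable_itvT.
  - exact: measurable_itv0.
  - move=> x; rewrite /= in_itv /= => /andP[x0 xp]; split=> //.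
    by rewrite lte_fin; exact: le_lt_trans pq.
  - exact: sub_itv0.
rewrite -EFinD lee_fin -lerBlDl.
apply: le_trans (primitive_ubound wE0 wEd W_fin Iq p0 (ltW pq)) _ => /=.
rewrite mulrC -ler_pdivlMr // lerBlDl.
by rewrite /q ge_min lexx orbT.
Qed.

(** [u] is averaged over the intervals between the points [W (m k)]. The resulting step function is
    submajorized by [u], so [res] applies to it, and [average_step] with the chord slopes of [F]
    bounds the sum of the [e * U (W (m k))]. These dominate the left side since [p k <= m k].
    Boundedness of [u] keeps [U] finite. *)
Let chain_bound (u : R -> R) (M e : R) K (p : nat -> R) :
  E u -> fnorm E u <= 1 -> 0 <= M -> (forall x, J x -> `|u x| <= M) -> 0 < e ->
  (forall k, (k < K)%N -> I (p k) /\ k.+1%:R * e < L (p k)) ->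
  (\sum_(k < K) e%:E * \int[leb]_(t in (itv0 (W (p k))%:E : set T)) `|u t|%:E
    <= N%:E)%E.
Proof.
move=> Eu u1 M0 uM e0 pL.
have mu : L0 J u by exact: (bfs_sub E_bfs).
pose us := rearr leb J u.
have usM t : 0 <= t -> (us t <= M%:E)%E.
  move=> t0; rewrite /us (rearr_leb mJ mu) (rearr_le mJ (@w10 J) (@mw1 J) _ mu M0).
  rewrite /distr (_ : _ `&` _ = set0) ?wmeas1 ?measure0 ?lee_fin //.
  by apply/seteqP; split=> // x [Jx] /=; rewrite ltNge uM.
have us0 t : J t -> (0 <= us t)%E by move=> _; exact: rearr_ge0.
have usd : {in J &, {homo us : x y / x <= y >-> (y <= x)%E}}.
  by move=> x y _ _; exact: rearr_anti.
have us_fin t : J t -> (\int[leb]_(x in (itv0 t%:E : set T)) us x < +oo)%E.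
  move=> [t0 _].
  apply: (@le_lt_trans _ _ (\int[leb]_(x in (itv0 t%:E : set T)) M%:E)%E).
    apply: (@ge0_le_integral _ T R leb _ (measurable_itv0 _) us (fun=> M%:E)
      (fun _ _ => rearr_ge0 _ _ _ _) (@measurable_rearr _ _ _ _ _)
      (@measurable_cst _ _ _ _ _ _)).
    by move=> x [/ltW x0 _]; exact: usM.
  by rewrite integral_itv0_cst ?lee_fin 1?ltW // -EFinM ltry.
pose U := primitive us.
have UK t : J t -> (\int[leb]_(x in (itv0 t%:E : set T)) us x = (U t)%:E)%E.
  by move=> [_ tb]; exact: (primitiveK us0 us_fin).
have U_homo s t : J t -> s <= t -> U s <= U t.
  by move=> [_ tb]; exact: (primitive_homo us0 usd us_fin).
have [m [mp m0 m_anti mF]] := level_fun_chain F0 W0 F_homo W_incr e0 pL.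
pose y k := W (m k).
have yJ k : (k < K)%N -> J (y k) by move=> /mp[Im _]; exact: JW.
have y0 k : (K <= k)%N -> y k = 0 by move=> /m0 mk; rewrite /y mk.
have y_anti k : y k.+1 <= y k.
  apply: W_homo; last exact: m_anti.
  have [/mp[[]]//|/m0 ->] := ltnP k K; exact: a_gt0.
have [c [c0 cU cF]] := average_step (fun t (Jt : J t) => Jt.1)
  (primitive_nonpos us (lexx 0)) (fun t Jt => fine_ge0 (us0 t Jt)) U_homo
  (fun s t => @primitive_lbound R b us us0 usd us_fin s t)
  (fun s t => @primitive_ubound R b us us0 usd us_fin s t)
  (fun s x t => @primitive_chord R b us us0 usd us_fin s x t) yJ y0 y_anti.
have ImK k : (k < K)%N -> I (m k) by move=> /mp[].
apply: (@le_trans _ _ (\sum_(k < K) (c k)%:E *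
    \int[leb]_(t in (itv0 (m k)%:E : set T)) fs t)%E); last first.
  apply: res => //; apply: le_trans u1.
  apply: (@step_norm_le K c y u Eu c0 yJ) => x Jx.
  by rewrite UK // lee_fin; apply: cU => //; case: Jx => /ltW.
apply: (@le_trans _ _ (\sum_(k < K) e * U (y k))%:E).
  rewrite -sumEFin; apply: lee_sum => -[k kK] _ /=; rewrite EFinM.
  apply: lee_wpmul2l; first by rewrite lee_fin ltW.
  have [Ip _] := pL k kK; have [Im pm] := mp k kK.
  apply: le_trans (integral_le_rearr mu (JW Ip)) _.
  rewrite (UK _ (JW Ip)) lee_fin; apply: U_homo; first exact: yJ.
  by apply: W_homo => //; case: Im.
rewrite (_ : \sum_(k < K) _ = (\sum_(k < K) c k * F (m k))%:E)%E; last first.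
  rewrite -sumEFin; apply: eq_bigr => -[k kK] _ /=.
  by rewrite FK ?EFinM //; case: (ImK k kK).
rewrite lee_fin; apply: (cF e (fun k => F (m k))) => //; first exact: ltW.
by rewrite m0.
Qed.

Let lam := rearr (wmeas w) I L.
Let dL s := distr (wmeas w) I L s.

(** [chain_bound] sees single points above each level; exhausting each superlevel set of [L] by such
    points and monotone convergence give its full [w]-measure. *)
Let levels_bound (u : R -> R) (M e : R) K :
  E u -> fnorm E u <= 1 -> 0 <= M -> (forall x, J x -> `|u x| <= M) -> 0 < e ->
  (\sum_(k < K) e%:E *
     \int[leb]_(t in (itv0 (dL (k.+1%:R * e)) : set T)) `|u t|%:E <= N%:E)%E.
Proof.
(* The induction hypothesis only serves to discard an empty top level. If the top level has a point,
   that point lies in all lower levels too. *)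
move=> Eu u1 M0 uM e0; elim: K => [|K ih].
  have := @chain_bound u M e 0 (fun=> 0) Eu u1 M0 uM e0.
  by rewrite !big_ord0; apply.
pose A k : set R := I `&` [set x | k.+1%:R * e < `|L x|].
have [[z Az]|nA] := pselect (A K !=set0); last first.
  have dK0 : dL (K.+1%:R * e) = 0%E.
    rewrite /dL /distr (_ : I `&` _ = set0) ?/wmeas ?integral_set0 //.
    by apply/seteqP; split=> // x Ax; apply: nA; exists x.
  rewrite big_ord_recr /= dK0 (_ : itv0 0%E = set0).
    by rewrite integral_set0 mule0 adde0.
  by apply/seteqP; split=> // x [x0]; rewrite lte_fin ltNge ltW.
have Adown k : downset I (A k).
  move=> x y [Iy /= yk] Ix xy; split=> //=; apply: lt_le_trans yk _.
  by rewrite !ger0_norm ?L_ge0 //; apply: L_anti; rewrite ?inE.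
have AzK k : (k < K.+1)%N -> A k z.
  move=> kK; case: Az => Iz /= zK; split=> //=; apply: le_lt_trans zK.
  by rewrite ler_pM2r // ler_nat.
have ex k : exists p : nat -> R, (k < K.+1)%N ->
    [/\ {homo p : m n / (m <= n)%N >-> m <= n}, forall n, A k (p n) &
        A k = \bigcup_n `]0, p n]%classic].
  have [kK|_] := ltnP k K.+1; last by exists (fun=> 0).
  have [||p pmon [pA pE]] := @downset_exhaust R a (A k) (@subIsetl _ _ _).
  - exact: Adown.
  - by exists z; exact: AzK.
  by exists p.
have [p pP] := choice ex.
have Ip k n : (k < K.+1)%N -> I (p k n) by move=> /pP[_ pA _]; case: (pA n).
have itvE k : (k < K.+1)%N ->
    \bigcup_n itv0 (W (p k n))%:E = itv0 (dL (k.+1%:R * e)).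
  move=> kK; have [pmon pA pE] := pP k kK.
  have mA : measurable (A k : set T) by exact: (measurable_distr_set mI _ mL).
  apply/seteqP; split=> x.
    move=> [n _ [x0 xW]]; split=> //; apply: lt_le_trans xW _.
    rewrite -WK; last exact: Ip.
    apply: (wmeas_le mI w0 mw) => //; first exact: measurable_itv0.
    move=> y [y0]; rewrite lte_fin => /ltW yp; apply: (Adown _ _ _ (pA n)) => //.
    by apply: itv0_le (Ip k n kK) _ _.
  move=> [x0 xd]; apply: contrapT => nx; move: xd; apply/negP; rewrite -leNgt.
  rewrite /dL /distr -/(A k) pE.
  apply: (wmeas_bigcup_le mI w0 mw).
  - by move=> n; exact: measurable_itvT.
  - move=> m n mn y; rewrite /= !in_itv /= => /andP[-> yp] /=.
    by apply: le_trans yp _; exact: pmon.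
  - move=> n y; rewrite /= in_itv /= => /andP[y0 yp].
    exact: itv0_le (Ip k n kK) _ _.
  - move=> n; apply: le_trans (wmeas_oc (Ip k n kK)) _.
    rewrite lee_fin leNgt; apply/negP => xW; apply: nx; exists n => //.
have mu : measurable_fun (J : set T) (fun t => `|u t|%:E).
  by apply: L0_EFin; apply: L0_norm; exact: (bfs_sub E_bfs).
have ucvg (k : 'I_K.+1) :
    (\int[leb]_(t in (itv0 (W (p k n))%:E : set T)) `|u t|%:E)%E @[n --> \oo]
    --> (\int[leb]_(t in (itv0 (dL (k.+1%:R * e)) : set T)) `|u t|%:E)%E.
  rewrite -itvE //; have [pmon _ _] := pP k (ltn_ord k).
  apply: (@ge0_nondecreasing_set_cvg_integral _ T R
    (fun n => itv0 (W (p k n))%:E : set T) (fun t => `|u t|%:E) leb).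
  - move=> m n mn; rewrite subsetEset; apply: subset_itv0; rewrite lee_fin.
    by apply: W_homo; [case: (Ip k n (ltn_ord k))|exact: pmon].
  - by move=> n; exact: measurable_itv0.
  - move=> n; apply: measurable_funS mu => //; apply: sub_itv0.
    exact: JW (Ip k n (ltn_ord k)).
  - by move=> n t _; rewrite lee_fin.
have sumcvg : (\sum_(k < K.+1) e%:E *
     \int[leb]_(t in (itv0 (W (p k n))%:E : set T)) `|u t|%:E)%E @[n --> \oo]
   --> (\sum_(k < K.+1) e%:E *
     \int[leb]_(t in (itv0 (dL (k.+1%:R * e)) : set T)) `|u t|%:E)%E.
  apply: cvg_nnesum => k _.
    apply: nearW => n; apply: mule_ge0; first by rewrite lee_fin ltW.
    by apply: integral_ge0 => t _; rewrite lee_fin.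
  by apply: cvgeZl => //; exact: ucvg.
rewrite -(cvg_lim _ sumcvg) //; apply: lime_le; first exact: (cvgP _ sumcvg).
apply: nearW => n; apply: (@chain_bound u M e K.+1 (fun k => p k n)) => // k kK.
split; first exact: Ip.
have [_ pA _] := pP k kK; have [Ipk /=] := pA n.
by rewrite ger0_norm // L_ge0.
Qed.

Let mlam c : measurable_fun (itv0 c : set T) lam.
Proof. exact: measurable_rearr. Qed.

Let lam0 t : (0 <= lam t)%E. Proof. exact: rearr_ge0. Qed.

Let bounded_bound (u : R -> R) (M : R) :
  E u -> fnorm E u <= 1 -> 0 <= M -> (forall x, J x -> `|u x| <= M) ->
  (\int[leb]_(t in (J : set T)) (lam t * `|u t|%:E) <= N%:E)%E.
Proof.
move=> Eu u1 M0 uM.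
have mu : measurable_fun (J : set T) (fun t => `|u t|%:E).
  by apply: L0_EFin; apply: L0_norm; exact: (bfs_sub E_bfs).
apply: (@le_layer _ T R leb J mJ _ _ (@mlam b) mu (fun _ _ => lam0 _)
  (fun t _ => normr_ge0 (u t))) => e K e0.
apply: le_trans (levels_bound K Eu u1 M0 uM e0).
apply: lee_sum => k _; apply: lee_wpmul2l; first by rewrite lee_fin ltW.
have s0 : 0 <= k.+1%:R * e by rewrite mulr_ge0 // ltW.
rewrite (level_rearr mI w0 mw _ mL s0) itv0I min_r //.
exact: (distr_le_wmeas mI w0 mw _ mL).
Qed.

Let lam_bound (u : R -> R) : E u -> fnorm E u <= 1 ->
  (\int[leb]_(t in (J : set T)) (lam t * `|u t|%:E) <= N%:E)%E.
Proof.
move=> Eu u1; have mu : L0 J u by exact: (bfs_sub E_bfs).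
have mu' : measurable_fun (J : set T) (fun t => `|u t|%:E).
  exact: L0_EFin (L0_norm mu).
under eq_integral do rewrite muleC.
apply: (@le_layer _ T R leb J mJ _ _ mu' (@mlam b)
  (fun t _ => normr_ge0 (u t)) (fun _ _ => lam0 _)) => e K e0.
(* [M] exceeds every threshold [(k+1) e] with [k < K], so truncating [u] at [M] leaves these layers
   unchanged. *)
pose M := K.+1%:R * e; have M0 : 0 <= M by rewrite mulr_ge0 // ltW.
pose v t := Num.min `|u t| M.
have v0 t : 0 <= v t by rewrite le_min normr_ge0 M0.
have mv : L0 J v.
  by apply: measurable_minr; [exact: L0_norm mu|exact: measurable_cst].
have [|Ev vu] := @fs_le _ _ _ E_bfs v u mv Eu.
  by move=> t _; rewrite (ger0_norm (v0 t)) ge_min lexx.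
have := @bounded_bound v M Ev (le_trans vu u1) M0.
have vM t : J t -> `|v t| <= M by move=> _; rewrite (ger0_norm (v0 t)) ge_min lexx orbT.
move=> /(_ vM); apply: le_trans.
under [leRHS]eq_integral do rewrite muleC.
apply: le_trans (@layer_le _ T R leb J mJ _ _ (L0_EFin (L0_norm mv)) (@mlam b)
  (fun t _ => normr_ge0 (v t)) (fun _ _ => lam0 _) e K (ltW e0)).
rewrite le_eqVlt; apply/orP; left; apply/eqP; apply: eq_bigr => k _.
congr (_ * _)%E; congr (integral _ _ _); congr (_ `&` _); apply/funext => t /=.
rewrite !lte_fin (ger0_norm (v0 t)) /v lt_min [X in _ && X](_ : _ = true) ?andbT //.
by rewrite /M ltr_pM2r // ltr_nat ltnS ltn_ord.
Qed.

(** Choose [p] with [W p < t]: as [L] is nonincreasing, it exceeds [L p] only on [(0, p)], so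
    [lam t] is at most [L p]. *)
Let lam_fin t : J t -> lam t \is a fin_num.
Proof.
move=> [t0 tb]; rewrite ge0_fin_numE //.
have [x1 Ix1] : exists x, I x.
  by have [p _ [pI _]] := itv0_exhaust a_gt0; exists (p 0%N).
have [p /andP[p0 px] Wp] := primitive_small wE0 wEd W_fin Ix1 t0.
have Ip : I p by exact: itv0_le Ix1 _ _.
apply: (@le_lt_trans _ _ (L p)%:E); last exact: ltry.
rewrite /lam (rearr_le mI w0 mw _ mL (L_ge0 Ip)).
apply: (@le_trans _ _ (W p)%:E); last by rewrite lee_fin ltW.
rewrite -WK //; apply: (wmeas_le mI w0 mw) => //.
- exact: measurable_distr_set.
- exact: measurable_itv0.
- move=> x [Ix] /=; rewrite ger0_norm ?L_ge0 // => Lx.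
  split; first by case: Ix.
  rewrite lte_fin ltNge; apply/negP => pxx; move: Lx; apply/negP.
  by rewrite -leNgt; apply: L_anti; rewrite ?inE.
- exact: sub_itv0.
Qed.

(** The witness [L w] is nonincreasing, so its rearrangement is at most itself; dividing by [w]
    gives at most [L], and [lam_bound] controls the gauge. *)
Lemma level_majorant : exists g, [/\ M_space I J w (kothe_dual J E) g,
  submajorized I f g & fnorm (M_space I J w (kothe_dual J E)) g <= N].
Proof.
pose g x := L x * w x.
have g0 x : I x -> 0 <= g x by move=> Ix; rewrite mulr_ge0 ?L_ge0 ?w0.
have g_anti : {in I &, {homo g : x y / x <= y >-> y <= x}}.
  move=> x y xI yI xy; apply: ler_pM; first exact/L_ge0/set_mem.
  - exact/w0/set_mem.
  - exact: L_anti.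
  - exact: w_decr.
have mg : L0 I g by exact: L0M.
have gsg x : I x -> (rearr leb I g x <= (g x)%:E)%E.
  exact: rearr_le_nonincreasing.
have rdL x : I x -> (0 <= rearr_div I w g x <= (L x)%:E)%E.
  move=> Ix; have wx := w_gt0 Ix; rewrite /rearr_div mule_ge0 ?rearr_ge0 //=; last first.
    by rewrite lee_fin invr_ge0 ltW.
  have -> : (L x)%:E = ((g x)%:E * (w x)^-1%:E)%E.
    by rewrite -EFinM /g mulfK // gt_eqF.
  by apply: lee_wpmul2r; [rewrite lee_fin invr_ge0 ltW|exact: gsg].
have rd_fin x : I x -> rearr_div I w g x \is a fin_num.
  move=> /rdL/andP[r0 rL]; rewrite ge0_fin_numE //.
  exact: le_lt_trans rL (ltry _).
pose psi := fine \o rearr_div I w g.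
have psi0 x : I x -> 0 <= psi x.
  by move=> Ix; apply: fine_ge0; case/andP: (rdL x Ix).
have psiL x : I x -> `|psi x| <= `|L x|.
  move=> Ix; rewrite !ger0_norm ?psi0 ?L_ge0 // -lee_fin fineK ?rd_fin //.
  by case/andP: (rdL x Ix).
have mpsi : L0 I psi.
  have mr := measurable_rearr_div w_gt0 w_decr g.
  by apply: measurableT_comp.
pose chi := rearr (wmeas w) I psi.
have chil t : (chi t <= lam t)%E by exact: (rearr_mono mI w0 mw).
have chi0 t : (0 <= chi t)%E by exact: rearr_ge0.
have chi_fin t : J t -> chi t \is a fin_num.
  move=> Jt; rewrite ge0_fin_numE //; apply: le_lt_trans (chil t) _.
  by rewrite -ge0_fin_numE ?lam_fin.
have gaugeN : (kothe_gauge J E (fine \o chi) <= N%:E)%E.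
  apply: ge_ereal_sup => _ [u [Eu u1] <-].
  apply: le_trans (lam_bound Eu u1).
  have mu : L0 J u by exact: (bfs_sub E_bfs).
  apply: (@ge0_le_integral _ T R leb J mJ).
  - by move=> t _; rewrite lee_fin.
  - exact: L0_EFin (L0_norm (L0M (@measurable_fine_rearr _ _ _ _) mu)).
  - exact: emeasurable_funM (@mlam b) (L0_EFin (L0_norm mu)).
  move=> t Jt; rewrite normrM EFinM; apply: lee_wpmul2r; first by rewrite lee_fin.
  rewrite ger0_norm; last exact: fine_ge0.
  by rewrite fineK ?chi_fin.
have gauge0 : (0 <= kothe_gauge J E (fine \o chi))%E.
  by apply: kothe_gauge_ge0 _ _ (bfs_zero E_bfs) _; rewrite (bfs_norm0 E_bfs).
exists g; split.
- split=> //; split; first exact: ae_onW.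
  split=> //; split; first exact: ae_onW.
  split; first exact: measurable_fine_rearr.
  exact: le_lt_trans gaugeN (ltry _).
- move=> x Ix; rewrite FK; last by case: Ix.
  apply: le_trans (F_le Ix) _.
  apply: le_trans (integral_le_rearr mg Ix).
  rewrite le_eqVlt; apply/orP; left; apply/eqP; apply: eq_integral => t.
  by rewrite inE => /(sub_itv0 Ix) It; rewrite ger0_norm ?g0.
- have -> : fnorm (M_space I J w (kothe_dual J E)) g = fine (kothe_gauge J E (fine \o chi)).
    by [].
  rewrite -lee_fin fineK // ge0_fin_numE //.
  exact: le_lt_trans gaugeN (ltry _).
Qed.

End level_majorant.

(** * Equality of the dual of Lambda and of [Q], with norms *)

Section kothe_duality.
Context {R : realType}.
Variables (a : \bar R) (w : R -> R) (E : funSpace R).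
Local Notation I := (itv0 a).
Local Notation J := (itv0 (wmeas w I)).
Local Notation Lambda := (Lambda_space I J w E).
Local Notation M := (M_space I J w (kothe_dual J E)).
Hypotheses (a_gt0 : (0 < a)%E) (w_gt0 : forall x, I x -> 0 < w x)
  (w_decr : {in I &, {homo w : x y / x <= y >-> y <= x}})
  (W_fin : forall t, I t ->
    (\int[leb]_(x in (itv0 t%:E : set (lebesgueType R))) (w x)%:E < +oo)%E)
  (E_bfs : is_banach_function_space J E)
  (E_fs : is_fully_symmetric J E) (E_supp : has_support J E).

Let norm_M g : M g -> (fnorm M g)%:E =
  kothe_gauge J E (fine \o rearr (wmeas w) I (fine \o rearr_div I w g)).
Proof.
move=> [_ [_ [_ [_ [_ gfin]]]]].
have g0 : (0 <= kothe_gauge J E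
    (fine \o rearr (wmeas w) I (fine \o rearr_div I w g)))%E.
  by apply: kothe_gauge_ge0 _ _ (bfs_zero E_bfs) _; rewrite (bfs_norm0 E_bfs).
by rewrite -[RHS]fineK // ge0_fin_numE.
Qed.

Let norm_M_ge0 g : M g -> 0 <= fnorm M g.
Proof.
move=> Mg; rewrite -lee_fin norm_M //.
by apply: kothe_gauge_ge0 _ _ (bfs_zero E_bfs) _; rewrite (bfs_norm0 E_bfs).
Qed.

Let gauge_le_norm_M f g : L0 I f -> M g -> submajorized I f g ->
  (kothe_gauge I Lambda f <= (fnorm M g)%:E)%E.
Proof.
move=> mf Mg fg; rewrite norm_M //; apply: ge_ereal_sup => _ [u [Lu u1] <-].
exact: (integral_le_kothe_gauge a_gt0 w_gt0 w_decr mf Mg fg Lu u1).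
Qed.

(** The empty step function lies in the unit ball of Lambda; a supremum over an empty family would
    be [-oo]. *)
Let gauge_ge0 f : (0 <= kothe_gauge I Lambda f)%E.
Proof.
have [//|//|//|//|Lz Lz_le] := @step_Lambda R a w E a_gt0 w_gt0 w_decr W_fin E_bfs
  E_supp 0 (fun=> 0) (fun=> 0) (fun=> set0).
apply: (kothe_gauge_ge0 _ _ Lz); apply: le_trans Lz_le _.
rewrite (_ : (fun _ => _) = fun=> 0) ?(bfs_norm0 E_bfs) //.
by apply/funext => t; rewrite big_ord0.
Qed.

(** Taking [N] equal to the dual gauge itself, with no slack, is what makes the infimum in the norm
    of [Q] a minimum. *)
Let majorant f : L0 I f -> (kothe_gauge I Lambda f < +oo)%E ->
  exists g, [/\ M g, submajorized I f g &
    ((fnorm M g)%:E <= kothe_gauge I Lambda f)%E].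
Proof.
move=> mf ffin; have fK := fineK (_ : kothe_gauge I Lambda f \is a fin_num).
rewrite -fK ?ge0_fin_numE //.
have [|g [Mg fg gN]] := @level_majorant R a w E a_gt0 w_gt0 w_decr W_fin E_bfs
    E_fs E_supp f (fine (kothe_gauge I Lambda f)) mf.
  move=> u Lu u1; rewrite fK ?ge0_fin_numE //.
  by apply: ereal_sup_ubound; exists u.
by exists g; split=> //; rewrite lee_fin.
Qed.

Lemma kothe_dual_Lambda_carrier f :
  kothe_dual I Lambda f <-> Q_space I J w (kothe_dual J E) f.
Proof.
split=> [[mf ffin]|[mf [g Mg fg]]].
  by have [g [Mg fg _]] := majorant mf ffin; split=> //; exists g.
by split=> //; apply: le_lt_trans (gauge_le_norm_M mf Mg fg) (ltry _).
Qed.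

Lemma kothe_dual_Lambda_norm f : kothe_dual I Lambda f ->
  fnorm (kothe_dual I Lambda) f = fnorm (Q_space I J w (kothe_dual J E)) f.
Proof.
move=> [mf ffin]; have [g [Mg fg gN]] := majorant mf ffin.
have fE : kothe_gauge I Lambda f = (fnorm M g)%:E.
  by apply/eqP; rewrite eq_le gN gauge_le_norm_M.
transitivity (fnorm M g); first exact: (congr1 fine fE).
apply/eqP; rewrite eq_le; apply/andP; split.
  apply: lb_le_inf; first by exists (fnorm M g), g.
  move=> _ [h [Mh fh] <-]; have := gauge_le_norm_M mf Mh fh.
  by rewrite fE lee_fin.
by apply: ge_inf; [exists 0 => _ [h [Mh _] <-]; exact: norm_M_ge0|exists g].
Qed.

End kothe_duality.

Theorem corollary6p16 (R : realType) (a b : \bar R) (w : R -> R)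
    (E : funSpace R) (I J : set R)
    (a_gt0 : (0 < a)%E) (I_def : I = itv0 a)
    (w_gt0 : forall x, I x -> 0 < w x)
    (w_decr : forall x y, I x -> I y -> x <= y -> w y <= w x)
    (W_fin : forall t, I t ->
      (\int[leb]_(x in (itv0 t%:E : set (lebesgueType R))) (w x)%:E < +oo)%E)
    (b_def : b = (\int[leb]_(x in (I : set (lebesgueType R))) (w x)%:E)%E)
    (J_def : J = itv0 b)
    (E_bfs : is_banach_function_space J E)
    (E_fs : is_fully_symmetric J E)
    (E_supp : has_support J E) :
  fcarrier (kothe_dual I (Lambda_space I J w E)) =
    fcarrier (Q_space I J w (kothe_dual J E)) /\
  (forall f, kothe_dual I (Lambda_space I J w E) f ->
    fnorm (kothe_dual I (Lambda_space I J w E)) f =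
      fnorm (Q_space I J w (kothe_dual J E)) f).
Proof.
subst I; have w_anti : {in itv0 a &, {homo w : x y / x <= y >-> y <= x}}.
  by move=> x y /set_mem Ix /set_mem Iy; exact: w_decr.
have JE : J = itv0 (wmeas w (itv0 a)) by rewrite J_def b_def.
clear J_def b_def; subst J; split.
  apply/funext => f; apply/propext.
  exact: (kothe_dual_Lambda_carrier a_gt0 w_gt0 w_anti W_fin E_bfs E_fs E_supp).
move=> f.
exact: (kothe_dual_Lambda_norm a_gt0 w_gt0 w_anti W_fin E_bfs E_fs E_supp).
Qed.
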